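(* Let $\nu$ be a Young diagram with $N\ge 2$ boxes and $r_1$ columns of lengths $c_1\ge\dots\ge c_{r_1}$, and let $d\ge c_1$. Let $\psi\in V^\nu\otimes S^\nu\subset\otimes^N\mathbb{C}^d$ be normalized. Then the entanglement entropy of the one-particle reduced density matrix $\operatorname{Tr}_{1\dots N-1}[|\psi\rangle\langle\psi|]$ on $\mathbb{C}^d$ (obtained by tracing out the first $N-1$ tensor factors) satisfies $$S\big(\operatorname{Tr}_{1\dots N-1}[|\psi\rangle\langle\psi|]\big)\ \ge\ \min_{(c_l,l)\text{ removable}}\ \ln\left(\prod_{i=1}^{c_l-1}\frac{h_{(i,l)}}{h_{(i,l)}-1}\right),$$ where the minimum is over all removable boxes $(c_l,l)$ of $\nu$, $h_{(i,l)}$ is the hook length of box $(i,l)$, and an empty product equals $1$.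
   Context: A Young diagram $\nu=(r_1,\dots,r_{c_1})$ with $N$ boxes has rows of lengths $r_1\ge\dots\ge r_{c_1}>0$ with $\sum_i r_i=N$; its columns have lengths $c_1\ge\dots\ge c_{r_1}$. Box $(i,j)$ is the box in row $i$ and column $j$. Its hook length is $h_{(i,j)}:=r_i-j+c_j-i+1$. A box is removable if deleting it leaves a valid Young diagram, i.e. it is at the end of both its row and its column (so it has the form $(c_l,l)$). Schur--Weyl duality: under the commuting actions of $U(d)$ ($U\mapsto U\otimes\dots\otimes U$) and of the symmetric group $S_N$ (permuting tensor factors), $\otimes^N\mathbb{C}^d=\bigoplus_{\mu\vdash N}V^\mu\otimes S^\mu$, where $V^\mu$ and $S^\mu$ are the irreducible representations of $U(d)$ and $S_N$ labelled by $\mu$ (with $V^\mu=0$ if $\mu$ has more than $d$ rows). Thus $V^\nu\otimes S^\nu$ is the $S^\nu$-isotypic subspace of $\otimes^N\mathbb{C}^d$. Convention: a single row corresponds to the fully symmetric subspace, a single column to the fully antisymmetric one. The entropy of a density matrix $\rho$ is $S(\rho)=-\operatorname{Tr}[\rho\ln\rho]$ (with $0\ln 0=0$). *)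

(* Defs.v *)
From HB Require Import structures.
From mathcomp Require Import all_boot all_order all_algebra all_fingroup.
From mathcomp Require Import spectral mxrepresentation.
From mathcomp Require Import complex.
From mathcomp Require Import reals ereal exp.

Set Implicit Arguments.
Unset Strict Implicit.
Unset Printing Implicit Defensive.

Import Order.TTheory GRing.Theory Num.Theory.

Local Open Scope ring_scope.

(** Rows, columns and boxes of a diagram are numbered from 1;
    tensor factors ['I_N] and basis vectors ['I_d] are numbered from 0. *)

Section YoungDiagram.
Local Open Scope nat_scope.

Definition is_young_diagram (nu : seq nat) (N : nat) : bool :=
  [&& sorted geq nu, all (leq 1) nu & sumn nu == N].

Definition row_len (nu : seq nat) (i : nat) : nat := nth 0 nu i.-1.

Definition col_len (nu : seq nat) (j : nat) : nat := count (leq j) nu.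

Definition in_diagram (nu : seq nat) (i j : nat) : bool :=
  (0 < i) && (0 < j <= row_len nu i).

(* The truncated subtractions are exact on the boxes of [nu]. *)
Definition hook (nu : seq nat) (i j : nat) : nat :=
  (row_len nu i - j) + (col_len nu j - i) + 1.

Definition removable (nu : seq nat) (i j : nat) : bool :=
  [&& in_diagram nu i j, j == row_len nu i & i == col_len nu j].

End YoungDiagram.

Section Specht.
Variables (F : fieldType) (nu : seq nat) (N : nat).

(* Row and column stabilisers of the tableau obtained by filling the rows of
   [nu], one after the other, with 0, ..., N-1: the entry k lies in row
   [reshape_index nu k] and column [reshape_offset nu k] (both from 0). *)
Definition row_stab : {set 'S_N} :=
  [set s : 'S_N | [forall k : 'I_N,
     reshape_index nu (s k) == reshape_index nu k]].

Definition col_stab : {set 'S_N} :=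
  [set s : 'S_N | [forall k : 'I_N,
     reshape_offset nu (s k) == reshape_offset nu k]].

Definition symS : {group 'S_N} := [set: 'S_N]%G.

Local Notation aS := (regular_repr F symS).

(* The Young symmetrizer a * b, where a is the sum of the row stabiliser and b
   the signed sum of the column stabiliser.  In MathComp, [s * t] is "s, then
   t" and representations act on row vectors from the right, so the left ideal
   F[S_N] * (a * b) for the usual composition is the right submodule generated
   by b * a. *)
Definition young_symmetrizer : 'M[F]_#|symS| :=
  (\sum_(q in col_stab) (-1) ^+ odd_perm q *: aS q) *m
  (\sum_(p in row_stab) aS p).

Definition specht_mx : 'M[F]_#|symS| :=
  cyclic_mx aS (gring_row young_symmetrizer).

Definition specht_repr : mx_representation F symS (\rank specht_mx) :=
  submod_repr (cyclic_mx_module aS (gring_row young_symmetrizer)).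

End Specht.

Section Tensor.
Variables (F : fieldType) (N d : nat).

(* The product basis e_(x 0) (x) ... (x) e_(x (N-1)) of the N-th tensor power
   of F^d; a tensor is the row vector of its coordinates in this basis. *)
Definition tbasis : finType := {ffun 'I_N -> 'I_d}.

Definition permute_factors (s : 'S_N) (x : tbasis) : tbasis :=
  [ffun k => x ((s^-1)%g k)].

Definition tensor_perm_mx (s : 'S_N) : 'M[F]_#|tbasis| :=
  \matrix_(i, j) (enum_val j == permute_factors s (enum_val i))%:R.

Lemma tensor_perm_mx_repr : mx_repr (symS N) tensor_perm_mx.
Proof.
split=> [|s t _ _].
  apply/matrixP=> i j; rewrite !mxE; congr (_%:R); congr nat_of_bool.
  have -> : permute_factors 1%g (enum_val i) = enum_val i.
    by apply/ffunP=> k; rewrite ffunE invg1 perm1.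
  by rewrite (inj_eq enum_val_inj) eq_sym.
apply/matrixP=> i j; rewrite !mxE.
rewrite (bigD1 (enum_rank (permute_factors s (enum_val i)))) //=.
rewrite !mxE enum_rankK eqxx mul1r big1 ?addr0 => [|k nek].
  congr (_ == _)%:R; apply/ffunP=> k.
  by rewrite !ffunE invMg permM.
rewrite !mxE; case: eqP => [ek|_]; last by rewrite mul0r.
by rewrite -ek enum_valK eqxx in nek.
Qed.

Canonical tensor_perm_repr := MxRepresentation tensor_perm_mx_repr.

(* The isotypic subspace of type [nu]: the sum of all the subrepresentations of
   the tensor power that are isomorphic to the Specht module of [nu]. *)
Definition in_isotypic (nu : seq nat) (psi : 'rV[F]_#|tbasis|) : Prop :=
  exists (I : finType) (U : I -> 'M[F]_#|tbasis|)
         (modU : forall i, mxmodule tensor_perm_repr (U i)),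
    (forall i, mx_rsim (submod_repr (modU i)) (specht_repr F nu N)) /\
    (psi <= \sum_i U i)%MS.

End Tensor.

Section Quantum.
Variable R : realType.
Local Notation C := R[i].

Definition normalized n (psi : 'rV[C]_n) : Prop :=
  \sum_i `|psi 0 i| ^+ 2 = 1.

Definition ketbra n (psi : 'rV[C]_n) : 'M[C]_n :=
  \matrix_(i, j) (psi 0 i * (psi 0 j)^*).

(* Tr_(1 ... N-1), for N > 0: the row index x and the column index y agree on
   the first N-1 tensor factors, over which one sums, and their last factors
   are the remaining indices a and b. *)
Definition ptrace_last (N d : nat) (A : 'M[C]_#|tbasis N d|) : 'M[C]_d :=
  \matrix_(a, b)
    \sum_(x : tbasis N d) \sum_(y : tbasis N d |
        [forall k : 'I_N, if (k < N.-1)%N then x k == y k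
                          else (x k == a) && (y k == b)])
      A (enum_rank x) (enum_rank y).

(* Logarithm of a positive semidefinite matrix, through its unitary
   diagonalisation.  Since [ln 0 = 0] in the library, the zero eigenvalues
   contribute 0 * ln 0 = 0 to the entropy. *)
Definition lnmx n (A : 'M[C]_n) : 'M[C]_n :=
  invmx (spectralmx A) *m
  diag_mx (map_mx (fun z : C => (ln (complex.Re z))%:C%C) (spectral_diag A)) *m
  spectralmx A.

(* The trace is a real number when [rho] is Hermitian. *)
Definition entropy n (rho : 'M[C]_n) : R :=
  - complex.Re (\tr (rho *m lnmx rho)).

Definition hook_bound (nu : seq nat) (l : nat) : R :=
  ln (\prod_(1 <= i < col_len nu l)
        ((hook nu i l)%:R / ((hook nu i l)%:R - 1))).

(* The minimum over the removable boxes, computed in the extended reals with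
   neutral element +oo. *)
Definition min_hook_bound (nu : seq nat) : \bar R :=
  \big[Order.min/+oo%E]_(1 <= l < (row_len nu 1).+1
                         | removable nu (col_len nu l) l)
    (hook_bound nu l)%:E.

End Quantum.

(* Main.v *)
Require Import Defs.
From HB Require Import structures.
From mathcomp Require Import all_boot all_order all_algebra all_fingroup.
From mathcomp Require Import spectral sesquilinear mxrepresentation zify ring.
From mathcomp Require Import complex reals ereal exp.

(* Let P be the projection onto a unit vector v in the last tensor factor. The
   eigenvalues of the reduced density matrix are the numbers <psi|P|psi>, so it
   suffices to bound these by the largest inverse hook product.

   The Young symmetrizer is a joint eigenvector of the Jucys-Murphy elements
   X_k = sum_(i < k) (i k), with the contents of the row-reading tableau as
   eigenvalues (Garnir relations); exchanging neighbours in Young's seminormal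
   form then decomposes the isotypic component into joint eigenvectors whose
   eigenvalues are the contents of standard tableaux of shape nu. P commutes with
   S_(N-1), hence does not mix different tableaux.

   For a tableau whose last entry ends row r, the letters 1, ..., N-1 can be
   exchanged until the last r letters fill the ends of rows 1, ..., r. Let B be
   the antisymmetrization of the eigenvector over the last r letters but N, and
   a the antisymmetrization of B over the last r letters. On a the r projections
   onto v in the last r factors are mutually orthogonal, so r <a|P|a> <= <a|a>.
   A telescoping identity in the X_k gives <B|a> = R <B|B> and
   <B|P|a> = R <B|P|B>, where R is the hook product, and this yields
   R <B|P|B> <= <B|B>. *)

Set Implicit Arguments.
Unset Strict Implicit.
Unset Printing Implicit Defensive.

Import Order.TTheory GRing.Theory Num.Theory.
Local Open Scope ring_scope.
Local Open Scope sesquilinear_scope.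

(** * Jucys-Murphy elements *)

Section JucysMurphy.
Variables (F : fieldType) (n m : nat) (rG : mx_representation F (symS n.+1) m).
Implicit Types (g h : 'S_n.+1) (i j k l : nat).

Lemma repr_symM g h : rG (g * h)%g = rG g *m rG h.
Proof. by rewrite repr_mxM ?inE. Qed.

(* Indices are natural numbers, so that neighbours are [k] and [k.+1]; above [n]
   they have the junk value [inord k = 0]. *)
Definition trmx_of i j : 'M[F]_m := rG (tperm (inord i) (inord j)).
Definition trsum p k : 'M[F]_m := \sum_(p <= i < k) trmx_of i k.
Definition jmx k : 'M[F]_m := trsum 0 k.
Local Notation tr := trmx_of.
Local Notation sw k := (tr k k.+1).

Lemma trmx_ofC i j : tr i j = tr j i.
Proof. by rewrite /tr tpermC. Qed.

Lemma trmx_ofK i j : tr i j *m tr i j = 1%:M.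
Proof. by rewrite -repr_symM tperm2 repr_mx1. Qed.

Lemma repr_symJ g (a b : 'I_n.+1) :
  rG (tperm a b) *m rG g = rG g *m rG (tperm (g a) (g b)).
Proof. by rewrite -!repr_symM -tpermJ conjgC. Qed.

Lemma inord_eq i j : (i <= n)%N -> (j <= n)%N ->
  (inord i == inord j :> 'I_n.+1) = (i == j).
Proof. by move=> le_in le_jn; rewrite -val_eqE /= !inordK. Qed.

Lemma trmx_of_braid i j k : (i <= n)%N -> (j <= n)%N -> (k <= n)%N ->
  i != j -> i != k -> tr i j *m tr j k = tr j k *m tr i k.
Proof.
move=> ? ? ? ij ik; rewrite repr_symJ tpermL tpermD // inord_eq //.
  by rewrite eq_sym.
by rewrite eq_sym.
Qed.

(** Conjugation by [g] only permutes the summands of [trsum p k]. *)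
Lemma trsum_comm g p k : (k <= n)%N -> g (inord k) = inord k ->
  (forall i : 'I_n.+1, (p <= g i < k)%N = (p <= i < k)%N) ->
  trsum p k *m rG g = rG g *m trsum p k.
Proof.
move=> le_kn gk gi.
have ->: trsum p k = \sum_(i < n.+1 | (p <= i < k)%N) rG (tperm i (inord k)).
  rewrite /trsum big_geq_mkord.
  rewrite (big_ord_widen_cond n.+1 (fun i => p <= i)%N (fun i => tr i k)) 1?ltnW //.
  by apply: eq_bigr => i _; rewrite /tr inord_val.
rewrite mulmx_suml mulmx_sumr [RHS](reindex_inj (@perm_inj _ g)) /=.
by apply: eq_big => [i|i _]; rewrite ?gi // repr_symJ gk.
Qed.

Lemma trsum_tr i j p k : (i <= n)%N -> (j <= n)%N -> (k <= n)%N ->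
  i != k -> j != k -> (p <= i < k)%N = (p <= j < k)%N ->
  trsum p k *m tr i j = tr i j *m trsum p k.
Proof.
move=> ? ? le_kn ik jk ij; rewrite trsum_comm ?tpermD ?inord_eq // => a.
by case: tpermP => [->|->|//]; rewrite !inordK.
Qed.

Lemma jmx_tr i j k : (i <= n)%N -> (j <= n)%N -> (k <= n)%N ->
  i != k -> j != k -> (i < k)%N = (j < k)%N ->
  jmx k *m tr i j = tr i j *m jmx k.
Proof. by move=> *; apply: trsum_tr. Qed.

Lemma jmxC j k : (j <= n)%N -> (k <= n)%N -> jmx j *m jmx k = jmx k *m jmx j.
Proof.
wlog lt_jk : j k / (j < k)%N => [hw le_jn le_kn|le_jn le_kn].
  by case: (ltngtP j k) => [/hw->|/hw->|->].
rewrite [jmx j]/trsum mulmx_suml mulmx_sumr !big_nat; apply: eq_bigr => i ij.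
by rewrite jmx_tr //; lia.
Qed.

(** The degenerate affine Hecke relation: conjugation by [sw k] turns the terms of [jmx k] into
    those of [jmx k.+1] other than [sw k] itself, and that last term accounts for [1%:M]. *)
Lemma jmx_swl k : (k < n)%N -> sw k *m jmx k = jmx k.+1 *m sw k - 1%:M.
Proof.
move=> lt_kn; rewrite [jmx k.+1]/trsum big_nat_recr //= mulmxDl trmx_ofK addrK.
rewrite /jmx /trsum mulmx_suml mulmx_sumr !big_nat; apply: eq_bigr => i ik.
rewrite [tr k k.+1]trmx_ofC -trmx_of_braid 1?trmx_ofC //; lia.
Qed.

Lemma jmx_swr k : (k < n)%N -> jmx k *m sw k = sw k *m jmx k.+1 - 1%:M.
Proof.
move=> lt_kn; have := congr1 (fun A => sw k *m A *m sw k) (jmx_swl lt_kn).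
rewrite /= mulmxBr mulmxBl !mulmxA trmx_ofK mul1mx mulmx1 => ->.
by rewrite trmx_ofK -!mulmxA trmx_ofK mulmx1.
Qed.

Lemma jmx_swC j k : (j <= n)%N -> (k < n)%N -> j != k -> j != k.+1 ->
  jmx j *m sw k = sw k *m jmx j.
Proof. by move=> ? ? ? ?; rewrite jmx_tr //; lia. Qed.

End JucysMurphy.

(** * Sesquilinear forms *)

(** Makes the big-operator lemmas apply to the ordered products in [jmprod]. *)
HB.instance Definition _ (R : pzSemiRingType) m := Monoid.isLaw.Build
  'M[R]_m 1%:M mulmx (@mulmxA R m m m m) (@mul1mx R m m) (@mulmx1 R m m).

Section Form.
Variables (C : numClosedFieldType) (m : nat).
Implicit Types (H A : 'M[C]_m) (u v w : 'rV[C]_m).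

Definition sform H u v : C := (u *m H *m v ^t*) 0 0.

Lemma sformDl H u v w : sform H (u + v) w = sform H u w + sform H v w.
Proof. by rewrite /sform !mulmxDl mxE. Qed.
Lemma sformNl H u v : sform H (- u) v = - sform H u v.
Proof. by rewrite /sform !mulNmx mxE. Qed.
Lemma sformBl H u v w : sform H (u - v) w = sform H u w - sform H v w.
Proof. by rewrite sformDl sformNl. Qed.
Lemma sformZl H a u v : sform H (a *: u) v = a * sform H u v.
Proof. by rewrite /sform -!scalemxAl mxE. Qed.
Lemma sform0l H u : sform H 0 u = 0.
Proof. by rewrite /sform !mul0mx mxE. Qed.
Lemma sform_suml H I r (P : pred I) (E : I -> 'rV[C]_m) v :
  sform H (\sum_(i <- r | P i) E i) v = \sum_(i <- r | P i) sform H (E i) v.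
Proof.
by apply: (big_morph (fun u => sform H u v)) => [x y|]; rewrite ?sformDl ?sform0l.
Qed.
Lemma sformDr H u v w : sform H w (u + v) = sform H w u + sform H w v.
Proof. by rewrite /sform linearD /= map_mxD mulmxDr mxE. Qed.
Lemma sformNr H u v : sform H v (- u) = - sform H v u.
Proof. by rewrite /sform linearN /= map_mxN mulmxN mxE. Qed.
Lemma sformBr H u v w : sform H w (u - v) = sform H w u - sform H w v.
Proof. by rewrite sformDr sformNr. Qed.
Lemma sformZr H a u v : sform H v (a *: u) = a^* * sform H v u.
Proof. by rewrite /sform linearZ /= map_mxZ -scalemxAr mxE. Qed.
Lemma sform0r H u : sform H u 0 = 0.
Proof. by rewrite /sform trmx0 map_mx0 mulmx0 mxE. Qed.
Lemma sform_sumr H I r (P : pred I) (E : I -> 'rV[C]_m) v :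
  sform H v (\sum_(i <- r | P i) E i) = \sum_(i <- r | P i) sform H v (E i).
Proof.
by apply: (big_morph (sform H v)) => [x y|]; rewrite ?sformDr ?sform0r.
Qed.

Lemma sform_adj H A u v : A ^t* = A -> A *m H = H *m A ->
  sform H (u *m A) v = sform H u (v *m A).
Proof.
move=> hA AH; rewrite /sform trmx_mul map_mxM hA -[u *m A *m H]mulmxA AH.
by rewrite !mulmxA.
Qed.

Lemma sform_herm H u v : H ^t* = H -> sform H v u = (sform H u v)^*.
Proof.
move=> hH; rewrite /sform.
have -> : ((u *m H *m v ^t*) 0 0)^* = (u *m H *m v ^t*) ^t* 0 0.
  by rewrite !mxE.
by rewrite !(trmx_mul, map_mxM) /= hH trmxCK mulmxA.
Qed.

Lemma sform1E u : sform 1%:M u u = \sum_i `|u 0 i| ^+ 2.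
Proof.
by rewrite /sform mulmx1 mxE; apply: eq_bigr => i _; rewrite !mxE normCK.
Qed.

Lemma sform1_ge0 u : 0 <= sform 1%:M u u.
Proof. by rewrite sform1E sumr_ge0 // => i _; rewrite exprn_ge0. Qed.

Lemma sform1_eq0 u : sform 1%:M u u = 0 -> u = 0.
Proof.
rewrite sform1E => /psumr_eq0P h; apply/rowP => i; rewrite mxE.
have /eqP := h (fun j _ => exprn_ge0 2 (normr_ge0 _)) i isT.
by rewrite expf_eq0 normr_eq0 => /eqP.
Qed.

Lemma sform_proj H u v : H ^t* = H -> H *m H = H ->
  sform H u v = sform 1%:M (u *m H) (v *m H).
Proof.
move=> hH HH; rewrite sform_adj ?mul1mx ?mulmx1 // -mulmxA HH.
by rewrite -[RHS]sform_adj ?mul1mx ?mulmx1 // /sform mulmx1.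
Qed.

End Form.

(** * Products of shifted Jucys-Murphy elements *)

Section JucysMurphyProducts.
Variables (C : numClosedFieldType) (n m : nat).
Variable rG : mx_representation C (symS n.+1) m.
Hypothesis rGU : forall g, (rG g) ^t* = rG g^-1%g.
Local Notation tr := (trmx_of rG).
Local Notation jm := (jmx rG).
Local Notation sw k := (tr k k.+1).
Implicit Types (H : 'M[C]_m) (u v B : 'rV[C]_m) (p q i j k : nat) (x y z : C).

Lemma trmx_of_herm i j : (tr i j) ^t* = tr i j.
Proof. by rewrite rGU tpermV. Qed.

Lemma jmx_herm k : (jm k) ^t* = jm k.
Proof.
rewrite /jmx /trsum.
apply: (big_ind (fun A => A ^t* = A)) => [|A B hA hB|i _].
- by rewrite trmx0 map_mx0.
- by rewrite linearD /= map_mxD hA hB.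
- exact: trmx_of_herm.
Qed.

Definition jmprod y p q : 'M[C]_m :=
  \big[mulmx/1%:M]_(p <= i < q) (y%:M - jm i).

Lemma jmprod_recr y p q : (p <= q)%N ->
  jmprod y p q.+1 = jmprod y p q *m (y%:M - jm q).
Proof. by move=> ?; rewrite /jmprod big_nat_recr. Qed.

Lemma jmprod_recl y p q : (p < q)%N ->
  jmprod y p q = (y%:M - jm p) *m jmprod y p.+1 q.
Proof. by move=> ?; rewrite /jmprod big_ltn. Qed.

Lemma jmprod_nil y p q : (q <= p)%N -> jmprod y p q = 1%:M.
Proof. by move=> ?; rewrite /jmprod big_geq. Qed.

Lemma jmprod_comm y p q (A : 'M[C]_m) :
  (forall i, (p <= i < q)%N -> jm i *m A = A *m jm i) ->
  jmprod y p q *m A = A *m jmprod y p q.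
Proof.
move=> hA; rewrite /jmprod big_nat.
apply: (big_ind (fun U => U *m A = A *m U)) => [|U V hU hV|i ipq].
- by rewrite mul1mx mulmx1.
- by rewrite -mulmxA hV !mulmxA hU.
- by rewrite mulmxBl mulmxBr hA // scalar_mxC.
Qed.

Lemma jmlin_sw y k : (k < n)%N ->
  (y%:M - jm k) *m sw k = sw k *m (y%:M - jm k.+1) + 1%:M.
Proof.
move=> lt_kn; rewrite mulmxBl mulmxBr jmx_swr // scalar_mxC opprB.
by rewrite addrA addrAC.
Qed.

Lemma jmlinS_sw y k : (k < n)%N ->
  (y%:M - jm k.+1) *m sw k = sw k *m (y%:M - jm k) - 1%:M.
Proof.
move=> lt_kn; rewrite mulmxBl mulmxBr jmx_swl // scalar_mxC opprB.
by rewrite addrA addrAC addrK.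
Qed.

Lemma jmlinC y z j k : (j <= n)%N -> (k <= n)%N ->
  (y%:M - jm j) *m (z%:M - jm k) = (z%:M - jm k) *m (y%:M - jm j).
Proof.
move=> ? ?; apply: comm_mxB; first exact: comm_mx_scalar.
apply/comm_mx_sym/comm_mxB; first exact: comm_mx_scalar.
exact: jmxC.
Qed.

(** The product is symmetric in the commuting elements [jm i], and symmetric polynomials in [jm k]
    and [jm k.+1] commute with [sw k]. *)
Lemma jmprod_sw y p q k : (q <= n)%N -> (p <= k < q)%N ->
  jmprod y p q.+1 *m sw k = sw k *m jmprod y p q.+1.
Proof.
elim: q => [|q IHq]; first lia.
move=> lt_qn pkq; rewrite jmprod_recr; last lia.
have [->|kq] := eqVneq k q; last first.
  rewrite -mulmxA mulmxBl jmx_swC; try lia.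
  by rewrite -scalar_mxC -mulmxBr !mulmxA IHq //; lia.
rewrite jmprod_recr -?mulmxA; last lia.
(* The corrections [- 1%:M] and [+ 1%:M] from moving [sw q] past the two factors cancel. *)
have -> : (y%:M - jm q) *m ((y%:M - jm q.+1) *m sw q) =
          sw q *m ((y%:M - jm q) *m (y%:M - jm q.+1)).
  rewrite jmlinS_sw // mulmxBr mulmxA jmlin_sw // mulmxDl mul1mx mulmx1 addrK.
  by rewrite -mulmxA jmlinC // ltnW.
rewrite !mulmxA jmprod_comm // => i ipq.
by rewrite jmx_swC //; lia.
Qed.

(** Neighbour transpositions generate: [tr i j.+1] is the conjugate of [tr i j] by [sw j]. *)
Lemma comm_sw_comm_tr p q (A : 'M[C]_m) : (q <= n)%N ->
  (forall k, (p <= k < q)%N -> A *m sw k = sw k *m A) ->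
  forall i j, (p <= i <= q)%N -> (p <= j <= q)%N -> A *m tr i j = tr i j *m A.
Proof.
move=> le_qn hA; suff hlt i j : (p <= i)%N -> (i < j <= q)%N ->
    A *m tr i j = tr i j *m A.
  move=> i j ? ?; case: (ltngtP i j) => [?|?|->]; first by apply: hlt; lia.
    by rewrite trmx_ofC hlt //; lia.
  by rewrite /trmx_of tperm1 repr_mx1 mulmx1 mul1mx.
move=> le_pi; elim: j => [|j IHj] ijq; first lia.
have [->|ij] := eqVneq i j; first by apply: hA; lia.
have -> : tr i j.+1 = sw j *m tr i j *m sw j.
  by rewrite -mulmxA trmx_of_braid; [rewrite mulmxA trmx_ofK mul1mx|lia..].
have hj : A *m sw j = sw j *m A by apply: hA; lia.
by rewrite !mulmxA hj -[sw j *m A *m _]mulmxA IHj -?mulmxA ?hj //; lia.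
Qed.

End JucysMurphyProducts.

(** * Antisymmetrization *)

Section Antisymmetrization.
Variables (C : numClosedFieldType) (n m : nat).
Variable rG : mx_representation C (symS n.+1) m.
Hypothesis rGU : forall g, (rG g) ^t* = rG g^-1%g.
Local Notation tr := (trmx_of rG).
Local Notation jm := (jmx rG).
Local Notation jmprod := (jmprod rG).
Local Notation sw k := (tr k k.+1).
Implicit Types (H : 'M[C]_m) (u v B : 'rV[C]_m) (p q i j k : nat) (x y z : C).

Definition antisym p q B := forall i j, (p <= i < q)%N -> (p <= j < q)%N ->
  i != j -> B *m tr i j = - B.

(** For [B] antisymmetric in the letters p, ..., q-1, this is its antisymmetrization over p, ..., q
    up to normalization: the identity and the transpositions (i q) represent the cosets of the
    smaller symmetric group. *)
Definition antisymS p q B := B - B *m trsum rG p q.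

Lemma antisymSP p q B : (q <= n)%N -> antisym p q B ->
  antisym p q.+1 (antisymS p q B).
Proof.
move=> le_qn hB i j pi pj ij.
wlog lt_ij : i j pi pj ij / (i < j)%N => [hw|].
  by case: (ltngtP i j) ij => // ? _; [|rewrite trmx_ofC]; apply: hw => //; lia.
have [jq|jq] := eqVneq j q; last first.
  rewrite mulmxBl -mulmxA trsum_tr; try lia.
  by rewrite mulmxA hB ?mulNmx -?opprD //; lia.
rewrite jq /antisymS mulmxBl /trsum mulmx_sumr mulmx_suml.
(* For [l != i], (l q)(i q) = (i l)(l q) and [B] absorbs (i l) with a sign; for [l = i] the product
   is the identity. The exceptional term is kept as a separate summand so that the sum splits. *)
have hl l : (p <= l < q)%N -> B *m tr l q *m tr i q =
    - (B *m tr l q) + (if l == i then B *m tr i q + B else 0).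
  move=> pl; have [->|li] := eqVneq l i.
    by rewrite -mulmxA trmx_ofK mulmx1 addKr.
  rewrite addr0 -mulmxA.
  have -> : tr l q *m tr i q = tr i l *m tr l q by rewrite trmx_of_braid //; lia.
  by rewrite mulmxA hB ?mulNmx //; lia.
rewrite big_nat (eq_bigr _ hl) -big_nat big_split /= sumrN.
rewrite -big_mkcond /= big_nat1_eq; have -> : (p <= i < q)%N by lia.
by rewrite opprD opprK addrCA opprD addNKr opprB.
Qed.

Section Block.
Variables (H : 'M[C]_m) (p q : nat) (B : 'rV[C]_m) (z h0 h1 : C).
Hypotheses (lt_pq : (p < q)%N) (le_qn : (q <= n)%N) (hB : antisym p q B).
Hypotheses (hz : B *m jm q = z *: B) (zR : z^* = z).
Hypotheses (hh1 : B *m jmprod z p q = h1 *: B).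
Hypotheses (hh0 : B *m jmprod (z - 1) p q = h0 *: B).
Hypothesis HC : forall i j, (i < q)%N -> (j < q)%N -> tr i j *m H = H *m tr i j.

Let sform_tr u v i j : (i < q)%N -> (j < q)%N ->
  sform H (u *m tr i j) v = sform H u (v *m tr i j).
Proof. by move=> ? ?; rewrite sform_adj ?trmx_of_herm ?HC. Qed.

(* [T k = - T k.+1 *m sw k], so that all the [sform H (T k) B] are equal, while
   the sum of the [T k] telescopes. *)
Let T k := B *m jmprod z p k *m jmprod (z - 1) k.+1 q.

Let T_sw k : (p <= k)%N -> (k.+1 < q)%N -> T k.+1 *m sw k = - T k.
Proof.
move=> le_pk lt_kq; rewrite /T jmprod_recr // (jmprod_recl _ _ lt_kq).
set P := jmprod z p k; set V := jmprod (z - 1) k.+2 q.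
have VS : V *m sw k = sw k *m V.
  by rewrite jmprod_comm // => i ?; rewrite jmx_swC //; lia.
have PS : P *m sw k = sw k *m P.
  by rewrite jmprod_comm // => i ?; rewrite jmx_swC //; lia.
rewrite -!mulmxA VS [_ *m (sw k *m V)]mulmxA jmlin_sw; last lia.
rewrite mulmxDl mul1mx ![_ *m (_ + V)]mulmxDr mulmxDr !mulmxA.
rewrite -[B *m P *m sw k]mulmxA PS mulmxA.
rewrite hB; try lia.
rewrite !mulNmx addrC -opprB; congr (- _).
by rewrite [(z - 1)%:M]raddfB /= addrAC [_ *m (_ - 1%:M)]mulmxBr mulmx1 mulmxBl. 
Qed.

Let T_const k : (p <= k < q)%N -> sform H (T k) B = sform H (T q.-1) B.
Proof.
move=> /andP[le_pk lt_kq]; have le_kq : (k <= q.-1)%N by lia.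
move: {2}(q.-1 - k)%N (erefl (q.-1 - k)%N) => d; elim: d k le_pk lt_kq le_kq.
  by move=> k _ _ ? ?; have -> : k = q.-1 by lia.
move=> d IHd k le_pk lt_kq le_kq hd; rewrite -(IHd k.+1); try lia.
rewrite -[T k]opprK -T_sw; try lia.
rewrite sformNl sform_tr ?hB; try lia.
by rewrite sformNr opprK.
Qed.

Let T_sum : \sum_(p <= k < q) T k = (h1 - h0) *: B.
Proof.
rewrite scalerBl -hh1 -hh0.
rewrite -[B *m jmprod z p q]mulmx1 -(jmprod_nil rG (z - 1) (leqnn q)).
have -> : B *m jmprod (z - 1) p q = B *m jmprod z p p *m jmprod (z - 1) p q.
  by rewrite (jmprod_nil _ z (leqnn p)) mulmx1.
pose V k := B *m jmprod z p k *m jmprod (z - 1) k q.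
rewrite -[_ - _]/(V q - V p) -(telescope_sumr V) 1?ltnW //.
rewrite !big_nat; apply: eq_bigr => k /andP[le_pk lt_kq].
rewrite /V jmprod_recr // (jmprod_recl _ _ lt_kq).
rewrite mulmxA [_ *m (_ *m jmprod _ k.+1 q)]mulmxA -mulmxBl -mulmxBr.
by rewrite [(z - 1)%:M]raddfB /= opprB addrA subrK subKr mulmx1.
Qed.

(** By antisymmetry the q - p terms [sform H B (B *m tr i q)] coincide, and [h1] times their sum is
    [sform H (\sum_k T k) B]. The telescoped value [(h1 - h0) *: B] of that sum of vectors leaves
    exactly [h0]. *)
Lemma antisym_sform : h1 * sform H B (antisymS p q B) = h0 * sform H B B.
Proof.
have hsw i : (p <= i < q)%N ->
    sform H B (B *m tr i q) = sform H B (B *m sw q.-1).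
  move=> pi; have -> : q.-1.+1 = q by lia.
  have [->//|iq] := eqVneq i q.-1.
  have -> : tr i q = tr i q.-1 *m tr q.-1 q *m tr i q.-1.
    rewrite -mulmxA [tr q.-1 q]trmx_ofC [tr i q.-1]trmx_ofC.
    rewrite trmx_of_braid; [|lia..].
    by rewrite mulmxA trmx_ofK mul1mx trmx_ofC.
  rewrite !mulmxA -sform_tr; [|lia..].
  rewrite hB; [|lia..].
  by rewrite mulNmx sformNl sformNr opprK.
(* Write [h1 *: B] as [B *m jmprod z p q] and move its last factor to the other argument. As [z] is
   the eigenvalue of [jm q], the Hecke relation reduces [B *m sw q.-1 *m (z%:M - jm q.-1)] to
   [B]. *)
have hT : h1 * sform H B (B *m sw q.-1) = sform H (T q.-1) B.
  rewrite -sformZl -hh1; have {1}-> : q = q.-1.+1 by lia.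
  rewrite jmprod_recr ?mulmxA; last lia.
  rewrite sform_adj; last 2 first.
  - by rewrite linearB /= map_mxB jmx_herm // tr_scalar_mx map_scalar_mx /= zR.
  - rewrite mulmxBl mulmxBr scalar_mxC /jmx /trsum mulmx_suml mulmx_sumr.
    congr (_ - _); rewrite !big_nat; apply: eq_bigr => i ?; apply: HC; lia.
  rewrite mulmxBr mul_mx_scalar -mulmxA jmx_swl; last lia.
  have -> : q.-1.+1 = q by lia.
  rewrite mulmxBr mulmxA hz mulmx1 -scalemxAl subKr /T.
  by rewrite (@jmprod_nil _ _ _ _ (z - 1) q.-1.+1) ?mulmx1 //; lia.
rewrite /antisymS /trsum mulmx_sumr sformBr sform_sumr big_nat (eq_bigr _ hsw).
rewrite -big_nat sumr_const_nat mulrBr -mulr_natl mulrCA hT.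
have -> : (q - p)%:R * sform H (T q.-1) B = \sum_(p <= k < q) sform H (T k) B.
  by rewrite big_nat (eq_bigr _ T_const) -big_nat sumr_const_nat mulr_natl.
rewrite -sform_suml T_sum sformZl mulrBl opprB addrC subrK //.
Qed.
End Block.

End Antisymmetrization.

(** * Iterated antisymmetrization of a joint eigenvector *)

Section AntisymmetrizedEigenvector.
Variables (C : numClosedFieldType) (n m : nat).
Variable rG : mx_representation C (symS n.+1) m.
Hypothesis rGU : forall g, (rG g) ^t* = rG g^-1%g.
Local Notation tr := (trmx_of rG).
Local Notation jm := (jmx rG).
Local Notation jmprod := (jmprod rG).
Local Notation sw k := (tr k k.+1).
Local Notation antisym := (antisym rG).
Local Notation antisymS := (antisymS rG).

Variables (u : 'rV[C]_m) (x : nat -> C) (p : nat).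
Hypothesis ux : forall k, (k <= n)%N -> u *m jm k = x k *: u.
Hypothesis x_real : forall k, x k \is Num.real.
Hypothesis x_decr : forall i j, (p <= i)%N -> (i < j <= n)%N -> x j < x i.

Fixpoint antisym_iter s : 'rV[C]_m :=
  if s is s'.+1 then antisymS p (p + s'.+1) (antisym_iter s') else u.
Local Notation B := antisym_iter.

Definition chain_ratio q : C :=
  \prod_(p <= i < q) ((x i - x q + 1) / (x i - x q)).

Lemma chain_ratio_gt0 q : (q <= n)%N -> 0 < chain_ratio q.
Proof.
move=> le_qn; rewrite /chain_ratio big_nat prodr_gt0 // => i /andP[pi iq].
have lt_x : 0 < x i - x q by rewrite subr_gt0 x_decr ?iq.
by rewrite divr_gt0 // addr_gt0.
Qed.

Lemma antisym_iterP s : (p + s <= n)%N -> antisym p (p + s.+1) (B s).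
Proof.
elim: s => [|s IHs] le_n.
  by move=> i j pi pj; case/eqP; lia.
by rewrite [(p + _)%N]addnS; apply: antisymSP => //; apply: IHs; lia.
Qed.

Lemma antisym_iter_jm s k : (p + s < k <= n)%N -> B s *m jm k = x k *: B s.
Proof.
elim: s => [|s IHs] sk /=; first by rewrite ux //; lia.
have Yk : jm k *m trsum rG p (p + s.+1) = trsum rG p (p + s.+1) *m jm k.
  rewrite {1 2}/trsum [RHS]mulmx_suml [LHS]mulmx_sumr !big_nat.
  by apply: eq_bigr => i pi; rewrite jmx_tr //; lia.
rewrite /antisymS mulmxBl -mulmxA -Yk mulmxA IHs; last lia.
by rewrite -scalemxAl scalerBr.
Qed.

(** The product over the letters p, ..., p+s is symmetric in the [jm i], hence commutes with the
    permutations that build [B s] from [u]; so [B s] inherits the eigenvalue of [u], though it need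
    not be an eigenvector of each factor. *)
Lemma antisym_iter_jmprod s y : (p + s <= n)%N ->
  B s *m jmprod y p (p + s.+1) = (\prod_(p <= i < p + s.+1) (y - x i)) *: B s.
Proof.
have step (v : 'rV_m) q c : (p <= q)%N -> v *m jmprod y p q = c *: v ->
    v *m jm q = x q *: v -> v *m jmprod y p q.+1 = (c * (y - x q)) *: v.
  move=> le_pq hv vq; rewrite jmprod_recr // mulmxA hv -scalemxAl mulmxBr.
  by rewrite mul_mx_scalar vq -scalerBl scalerA.
elim: s => [|s IHs] le_n.
  rewrite addn1 big_nat_recr //=; apply: step; rewrite ?ux //; last lia.
  by rewrite jmprod_nil // big_geq // mulmx1 scale1r.
rewrite [(p + s.+2)%N]addnS big_nat_recr /=; last lia.
have hc : jmprod y p (p + s.+1).+1 *m trsum rG p (p + s.+1) =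
          trsum rG p (p + s.+1) *m jmprod y p (p + s.+1).+1.
  rewrite /trsum mulmx_suml mulmx_sumr !big_nat; apply: eq_bigr => i pi.
  apply: (@comm_sw_comm_tr _ _ _ _ p (p + s.+1)); try lia.
  by move=> k pk; apply: jmprod_sw; lia.
rewrite /antisymS mulmxBl -mulmxA -hc mulmxA.
rewrite (step _ _ _ _ (IHs _)) ?antisym_iter_jm //; try lia.
by rewrite -scalemxAl scalerBr.
Qed.

Lemma conjC_x k : (x k)^* = x k.
Proof. exact/CrealP/x_real. Qed.

(** The case q = [p + s.+1] of [antisym_sform]. Commutation with [H] concerns only the letters below
    q, so q = n is allowed for the projection [P] below. *)
Lemma antisym_iter_sform (H : 'M[C]_m) s : (p + s.+1 <= n)%N ->
    (forall i j, (i < p + s.+1)%N -> (j < p + s.+1)%N ->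
       tr i j *m H = H *m tr i j) ->
  sform H (B s) (B s.+1) = chain_ratio (p + s.+1) * sform H (B s) (B s).
Proof.
move=> le_n HC; set q := (p + s.+1)%N.
have h1_neq0 : \prod_(p <= i < q) (x q - x i) != 0.
  rewrite prodf_seq_neq0; apply/allP => i /=; rewrite mem_index_iota.
  by move=> /andP[pi iq]; rewrite subr_eq0 lt_eqF // x_decr ?iq.
apply: (mulfI h1_neq0).
rewrite (@antisym_sform _ _ _ rG rGU H p q (B s) (x q)
   (\prod_(p <= i < q) (x q - 1 - x i))) ?conjC_x //; try lia.
- rewrite mulrA -big_split /=; congr (_ * _); rewrite !big_nat.
  apply: eq_bigr => i /andP[pi iq].
  have xq : x i - x q != 0 by rewrite subr_eq0 gt_eqF // x_decr ?iq.
  by rewrite -[x q - x i]opprB mulNr mulrCA mulfV // mulr1 !opprD opprK; ring.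
- by apply: antisym_iterP; lia.
- by rewrite antisym_iter_jm //; lia.
- by rewrite antisym_iter_jmprod //; lia.
- by rewrite antisym_iter_jmprod //; lia.
Qed.

(** Each of the [s.+1] transpositions in [antisymS], moved to the antisymmetric vector [B s.+1],
    yields one more copy of the same value. *)
Lemma antisym_iter_sformS (H : 'M[C]_m) s : (p + s.+1 <= n)%N ->
    (forall i j, (i <= p + s.+1)%N -> (j <= p + s.+1)%N ->
       tr i j *m H = H *m tr i j) ->
  sform H (B s.+1) (B s.+1) = s.+2%:R * sform H (B s.+1) (B s).
Proof.
move=> le_n HC; rewrite {2}/B -/B /antisymS /trsum mulmx_sumr sformBr.
rewrite sform_sumr big_nat.
rewrite (eq_bigr (fun=> - sform H (B s.+1) (B s))) => [|i pi].
  by rewrite -big_nat sumr_const_nat mulNrn opprK addKn -mulrS mulr_natl.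
rewrite -sform_adj ?trmx_of_herm ?HC //; try lia.
by rewrite antisym_iterP ?sformNl //; lia.
Qed.

Definition chain_const s : C := \prod_(j < s) (j.+2%:R * chain_ratio (p + j.+1)).

Lemma chain_const_gt0 s : (p + s <= n)%N -> 0 < chain_const s.
Proof.
move=> le_n; rewrite prodr_gt0 // => j _.
by rewrite mulr_gt0 ?ltr0n ?chain_ratio_gt0 //; have := ltn_ord j; lia.
Qed.

(** The constant is the same for every [H], so it cancels when the forms of [P] and of the identity
    are compared. *)
Lemma antisym_iter_norm (H : 'M[C]_m) s : H ^t* = H -> (p + s < n)%N ->
    (forall i j, (i < n)%N -> (j < n)%N -> tr i j *m H = H *m tr i j) ->
  sform H (B s) (B s) = chain_const s * sform H u u.
Proof.
move=> hH lt_n HC; elim: s lt_n => [|s IHs] lt_n.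
  by rewrite /chain_const big_ord0 mul1r.
rewrite antisym_iter_sformS; try (by move=> *; apply: HC; lia); try lia.
rewrite sform_herm // antisym_iter_sform; try (by move=> *; apply: HC; lia); try lia.
rewrite rmorphM /= (CrealP (gtr0_real (chain_ratio_gt0 _))); last lia.
rewrite -sform_herm // IHs; last lia.
by rewrite /chain_const big_ord_recr /=; ring.
Qed.

Variable P : 'M[C]_m.
Hypotheses (hP : P ^t* = P) (PP : P *m P = P).
Hypothesis PC : forall i j, (i < n)%N -> (j < n)%N -> tr i j *m P = P *m tr i j.
Hypothesis P_antisym : forall q v, (q <= n)%N -> antisym q n.+1 v ->
  (n.+1 - q)%:R * sform P v v <= sform 1%:M v v.

Lemma sform_chain_le : (p <= n)%N ->
  chain_ratio n * sform P u u <= sform 1%:M u u.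
Proof.
have oC i j : tr i j *m 1%:M = 1%:M *m tr i j by rewrite mulmx1 mul1mx.
have o_herm : (1%:M : 'M[C]_m) ^t* = 1%:M by rewrite trmx1 map_mx1.
(* With one letter only, the ratio is an empty product and [P_antisym] applies to [u] itself. *)
move=> le_pn; have [pn|ne_pn] := eqVneq p n.
  rewrite /chain_ratio pn big_geq // mul1r.
  have := @P_antisym n u (leqnn n); rewrite subSnn mul1r; apply.
  by move=> i j ? ?; case/eqP; lia.
pose s := (n - p).-1; have def_n : (p + s.+1)%N = n by rewrite /s; lia.
have lt_n : (p + s < n)%N by lia.
have K_gt0 : 0 < chain_const s by rewrite chain_const_gt0 // ltnW.
have R_gt0 := chain_ratio_gt0 (leqnn n).
have R_real : (chain_ratio n)^* = chain_ratio n := CrealP (gtr0_real R_gt0).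
rewrite -(ler_pM2l K_gt0) mulrCA -!antisym_iter_norm //.
have nB : sform 1%:M (B s) (B s.+1) = chain_ratio n * sform 1%:M (B s) (B s).
  by rewrite antisym_iter_sform ?def_n.
have qB : sform P (B s) (B s.+1) = chain_ratio n * sform P (B s) (B s).
  by rewrite antisym_iter_sform ?def_n.
have naa : sform 1%:M (B s.+1) (B s.+1) =
    s.+2%:R * (chain_ratio n * sform 1%:M (B s) (B s)).
  rewrite antisym_iter_sformS ?def_n // sform_herm // nB rmorphM /= R_real.
  by rewrite -sform_herm.
(* Positivity of the norm of [(a - chain_ratio n *: b) *m P], a Cauchy-Schwarz argument. *)
have qaa : chain_ratio n ^+ 2 * sform P (B s) (B s) <= sform P (B s.+1) (B s.+1).
  move: (B s) (B s.+1) qB => b a qB.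
  have := sform1_ge0 (a *m P - (chain_ratio n *: b) *m P).
  rewrite -mulmxBl -sform_proj // sformBl !sformBr !sformZl !sformZr.
  rewrite [sform P a b]sform_herm // qB R_real rmorphM /= R_real.
  by rewrite -sform_herm // !mulrA subrr subr0 -expr2 subr_ge0.
have ha : antisym p n.+1 (B s.+1).
  have -> : n.+1 = (p + s.+2)%N by lia.
  by apply: antisym_iterP; lia.
have := P_antisym le_pn ha; have -> : (n.+1 - p)%N = s.+2 by lia.
rewrite naa ler_pM2l ?ltr0n // => hle.
have := le_trans qaa hle.
by rewrite expr2 -mulrA ler_pM2l.
Qed.

End AntisymmetrizedEigenvector.

(** * Standard tableaux as lattice words *)

Section Words.
Local Open Scope nat_scope.
Implicit Types (u v w : seq nat) (a b j k : nat).

(* A word lists the rows, numbered from 0, of the entries 0, 1, ... of a tableau;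
   row [j] of the shape of [u] has length [count_mem j u]. *)
Definition addable u a := (a == 0) || (count_mem a u < count_mem a.-1 u).

Fixpoint lattice_from u w :=
  if w is a :: w' then addable u a && lattice_from (rcons u a) w' else true.

Definition lattice w := lattice_from [::] w.

Definition box_content u a : int := (count_mem a u)%:Z - a%:Z.

Definition content w k := box_content (take k w) (nth 0 w k).

Lemma lattice_from_cat u v w :
  lattice_from u (v ++ w) = lattice_from u v && lattice_from (u ++ v) w.
Proof.
elim: v u => [|a v IHv] u /=; first by rewrite cats0.
by rewrite IHv andbA -cat_rcons.
Qed.

Lemma lattice_rcons u a : lattice (rcons u a) = lattice u && addable u a.
Proof. by rewrite /lattice -cats1 lattice_from_cat /= andbT. Qed.

Lemma eq_addable u v a : perm_eq u v -> addable u a = addable v a.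
Proof. by move=> /seq.permP uv; rewrite /addable !uv. Qed.

Lemma eq_lattice_from u v w : perm_eq u v -> lattice_from u w = lattice_from v w.
Proof.
elim: w u v => //= a w IHw u v uv; rewrite (eq_addable _ uv).
by rewrite (IHw _ (rcons v a)) // -!cats1 perm_cat2r.
Qed.

Lemma count_rcons j u a : count_mem j (rcons u a) = count_mem j u + (a == j).
Proof. by rewrite -cats1 count_cat /= addn0. Qed.

Lemma lattice_countS w j : lattice w -> count_mem j.+1 w <= count_mem j w.
Proof.
elim/last_ind: w j => [//|w a IHw] j; rewrite lattice_rcons => /andP[lw].
rewrite /addable !count_rcons => wa; have := IHw j lw.
have [eq_a|] := eqVneq a j.+1; last lia.
by move: wa; rewrite eq_a /=; lia.
Qed.

Lemma lattice_count w i j : lattice w -> i <= j -> count_mem j w <= count_mem i w.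
Proof.
move=> lw le_ij; rewrite -(subnK le_ij); elim: (j - i) => [//|d IHd].
by rewrite addSn (leq_trans (lattice_countS _ lw)).
Qed.

Lemma lattice_swapP u a b : lattice u -> addable u a -> addable (rcons u a) b ->
  [\/ a = b /\ box_content (rcons u a) b = (box_content u a + 1)%R,
      b = a.+1 /\ box_content (rcons u a) b = (box_content u a - 1)%R
    | [/\ a != b, addable u b, addable (rcons u b) a &
          (2 <= `|box_content u b - box_content u a|)%R] ].
Proof.
move=> lu ua uab; have [<-|ab] := eqVneq a b.
  by apply: Or31; split=> //; rewrite /box_content count_rcons eqxx; lia.
have [ub|nub] := boolP (addable u b); last first.
  apply: Or32; case: b ab uab nub => [//|b] ab.
  rewrite /addable !count_rcons /box_content count_rcons /= (negPf ab).
  by have := lattice_countS b lu; have [->|] := eqVneq a b; lia.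
apply: Or33; split=> //.
  move: ua; rewrite /addable !count_rcons [b == a]eq_sym (negPf ab); lia.
have ha : a = b.+1 -> count_mem a u < count_mem b u.
  by move=> e; move: ua; rewrite e.
have hb : b = a.+1 -> count_mem b u < count_mem a u.
  by move=> e; move: ub; rewrite e.
have := @lattice_count u a b lu; have := @lattice_count u b a lu.
by rewrite /box_content; lia.
Qed.

(** Each exchange carries the data of the third case of [lattice_swapP]; the content gap of at least
    2 keeps the factor of [intertwine_form] positive. *)
Inductive reach : seq nat -> seq nat -> Prop :=
| reach_refl w : reach w w
| reach_swap u a b v w :
    lattice u -> addable u a -> addable (rcons u a) b ->
    a != b -> addable u b -> addable (rcons u b) a ->
    (2 <= `|box_content u b - box_content u a|)%R ->
    reach (u ++ b :: a :: v) w -> reach (u ++ a :: b :: v) w.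

Lemma reach_trans w1 w2 w3 : reach w1 w2 -> reach w2 w3 -> reach w1 w3.
Proof.
move=> h h3; elim: h h3 => // u a b v w ? ? ? ? ? ? ? _ IH h3.
by apply: reach_swap => //; apply: IH.
Qed.

Lemma reach_cat t w w' : reach w w' -> reach (w ++ t) (w' ++ t).
Proof.
elim=> [u|u a b v x lu ua uab ab ub uba hc _]; first exact: reach_refl.
by rewrite -!catA => IH; apply: reach_swap.
Qed.

Lemma perm_swap u a b v : perm_eq (u ++ a :: b :: v) (u ++ b :: a :: v).
Proof. by rewrite perm_cat2l; apply/seq.permP => p /=; lia. Qed.

Lemma lattice_swap u a b v : addable u b -> addable (rcons u b) a ->
  lattice (u ++ a :: b :: v) -> lattice (u ++ b :: a :: v).
Proof.
rewrite /lattice !lattice_from_cat /= => -> -> /and4P[-> _ _ /=].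
rewrite (@eq_lattice_from _ (rcons (rcons u b) a)) // -!cats1 -!catA /=.
exact: perm_swap.
Qed.

Lemma reach_perm w w' : reach w w' -> perm_eq w w'.
Proof.
elim=> [//|u a b v x _ _ _ _ _ _ _ _ IH].
exact: perm_trans (perm_swap _ _ _ _) IH.
Qed.

Lemma reach_lattice w w' : reach w w' -> lattice w -> lattice w'.
Proof.
elim=> [//|u a b v x _ _ _ _ ub uba _ _ IH lw].
exact/IH/lattice_swap.
Qed.

Lemma split_last j w : j \in w -> exists u v, w = u ++ j :: v /\ j \notin v.
Proof.
elim: w => // a w IHw; have [/IHw[u [v [-> jv]]] _|jw] := boolP (j \in w).
  by exists (a :: u), v.
by rewrite inE (negPf jw) orbF => /eqP <-; exists [::], w.
Qed.

(** The last [j] is exchanged with each letter after it. Only the box directly below it could block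
    this, and then row [j.+1] would be as long as row [j]. *)
Lemma reach_removable w j : lattice w -> count_mem j.+1 w < count_mem j w ->
  exists w', reach w (rcons w' j).
Proof.
move=> lw hj; have jw : j \in w by rewrite -has_pred1 has_count; lia.
have [u [v [def_w jv]]] := split_last jw.
elim: v u w def_w lw hj jv {jw} => [|b v IHv] u w -> lw hj jv.
  by exists u; rewrite cats1; apply: reach_refl.
have lw' := lw; move: lw'; rewrite /lattice lattice_from_cat /=.
move=> /and4P[lu uj ujb _].
have bj : b != j by move: jv; rewrite inE eq_sym; case: eqP.
have ljv : count_mem j v = 0.
  by apply/count_memPn; move: jv; rewrite inE => /norP[].
case: (lattice_swapP lu uj ujb) => [[e]|[e hc]|[jb ub ubj hc]].
- by rewrite e eqxx in bj.
- move: hj hc; rewrite !count_cat /= ljv /box_content count_rcons e.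
  rewrite !eqxx [j.+1 == j]gtn_eqF // [j == j.+1]ltn_eqF //= => *; exfalso; lia.
have [|||w' hw'] := IHv (rcons u b) _ (erefl _).
- by rewrite cat_rcons; apply: lattice_swap.
- move: hj; rewrite cat_rcons (seq.permP (perm_swap u j b v)).
  by rewrite [X in _ < X](seq.permP (perm_swap u j b v)).
- by move: jv; rewrite inE => /norP[].
by exists w'; apply: reach_swap => //; rewrite -cat_rcons.
Qed.

(** The ends of rows r-1, r-2, ..., 0 are moved to the back one after the other, each in front of
    the previous ones. *)
Lemma reach_column w r : lattice (rcons w r) ->
  exists w', reach w (w' ++ iota 0 r).
Proof.
rewrite lattice_rcons => /andP[lw wr].
suff h d : d <= r -> exists w', reach w (w' ++ iota (r - d) d).
  by have [w'] := h r (leqnn r); rewrite subnn; exists w'.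
elim: d => [|d IHd] lt_dr; first by exists w; rewrite cats0; apply: reach_refl.
have [w1 h1] := IHd (ltnW lt_dr).
have l1 : lattice w1.
  by have := reach_lattice h1 lw; rewrite /lattice lattice_from_cat => /andP[].
have /seq.permP p1 := reach_perm h1.
(* Row [r - d.+1] is longer than the next row in [w1]: for [d = 0] because [r] can be added to [w],
   otherwise because the suffix already took an entry from the next row. *)
have [|w2 h2] := @reach_removable w1 (r - d.+1) l1.
  have e : (r - d.+1).+1 = r - d by lia.
  have := lattice_countS (r - d.+1) lw; rewrite e !p1 !count_cat.
  rewrite !(count_uniq_mem _ (iota_uniq _ _)) !mem_iota.
  case: d e lt_dr {IHd h1 p1} (p1) => [|d] e lt_dr p1; last lia.
  move: wr; rewrite /addable !p1 !count_cat /=. rewrite !subn0 subn1; lia.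
exists w2; apply: (reach_trans h1).
have -> : w2 ++ iota (r - d.+1) d.+1 = rcons w2 (r - d.+1) ++ iota (r - d) d.
  by rewrite cat_rcons /=; congr (_ ++ _ :: iota _ _); lia.
exact: reach_cat.
Qed.

Lemma first_difference (w w' : seq nat) : size w = size w' -> w != w' ->
  exists u a a' v v', [/\ w = u ++ a :: v, w' = u ++ a' :: v' & a != a'].
Proof.
elim: w w' => [|a w IHw] [|a' w'] //= [ws]; rewrite eqseq_cons.
have [<- /= ww'|aa' _] := eqVneq a a'; last by exists [::], a, a', w, w'.
have [u [b [b' [v [v' [-> -> bb']]]]]] := IHw _ ws ww'.
by exists (a :: u), b, b', v, v'.
Qed.

Lemma content_cat u a v : content (u ++ a :: v) (size u) = box_content u a.
Proof. by rewrite /content take_size_cat // nth_cat ltnn subnn. Qed.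

Lemma content_catl u v k : k < size u -> content (u ++ v) k = content u k.
Proof. by move=> ku; rewrite /content takel_cat 1?ltnW // nth_cat ku. Qed.

Lemma content_perm u u' v k : perm_eq u u' -> size u <= k ->
  content (u ++ v) k = content (u' ++ v) k.
Proof.
move=> uu' uk; rewrite /content /box_content !take_cat !nth_cat.
rewrite -(perm_size uu') ltnNge uk /= !count_cat.
by have /seq.permP-> := uu'.
Qed.

(** At the first difference, two distinct rows receive a box, and their contents differ because row
    lengths decrease. This is not the last position, as the last letter is determined by the others;
    hence it is an index whose Jucys-Murphy element commutes with [P]. *)
Lemma lattice_content_inj w w' : lattice w -> lattice w' -> perm_eq w w' ->
  w != w' -> exists2 k, k.+1 < size w & content w k != content w' k.
Proof.
move=> lw lw' ww' ne_ww'; have sw := perm_size ww'.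
have [u [a [a' [v [v' [def_w def_w' aa']]]]]] := first_difference sw ne_ww'.
exists (size u); last first.
  rewrite def_w def_w' !content_cat /box_content.
  move: lw; rewrite def_w /lattice lattice_from_cat => /andP[lu _].
  have := @lattice_count u a a' lu; have := @lattice_count u a' a lu; lia.
rewrite def_w size_cat /= -ltn_subLR; last lia.
case: v def_w => [|b v] def_w; last by rewrite /=; lia.
have := seq.permP ww' (pred1 a); rewrite def_w def_w' !count_cat /= eqxx.
move: sw; rewrite def_w def_w' !size_cat /= => /eqP; rewrite eqn_add2l eqSS.
by rewrite eq_sym size_eq0 => /eqP-> /=; rewrite [a' == a]eq_sym (negPf aa'); lia.
Qed.

End Words.

(** * Joint eigenvectors of the Jucys-Murphy elements *)

Section WeightVectors.
Variables (C : numClosedFieldType) (n m : nat).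
Variable rG : mx_representation C (symS n.+1) m.
Hypothesis rGU : forall g, (rG g) ^t* = rG g^-1%g.
Local Notation tr := (trmx_of rG).
Local Notation jm := (jmx rG).
Local Notation sw k := (tr k k.+1).
Implicit Types (w : seq nat) (e : 'rV[C]_m) (H : 'M[C]_m).

Definition weight_vector w e :=
  forall k, (k <= n)%N -> e *m jm k = (content w k)%:~R *: e.

(* [c] is the difference of the contents of the entries [k.+1] and [k]. *)
Definition intertwine k (c : int) e := e *m sw k - c%:~R^-1 *: e.

Lemma content_catS u a b v :
  content (u ++ a :: b :: v) (size u).+1 = box_content (rcons u a) b.
Proof. by rewrite -cat_rcons -(size_rcons u a) content_cat. Qed.

Lemma box_content_rcons u a b : a != b ->
  box_content (rcons u a) b = box_content u b.
Proof. by move=> ab; rewrite /box_content count_rcons (negPf ab) addn0. Qed.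

(** Young's seminormal form: the term [c%:~R^-1 *: e] compensates the constant in the Hecke
    relation, so that the two eigenvalues are exchanged. *)
Lemma intertwine_weight u a b v e (c := (box_content u b - box_content u a)%R) :
    (size u < n)%N -> a != b -> c != 0 ->
    weight_vector (u ++ a :: b :: v) e ->
  weight_vector (u ++ b :: a :: v) (intertwine (size u) c e).
Proof.
move=> lt_un ab c0 we; set k := size u; have ba : b != a by rewrite eq_sym.
have cC : (c%:~R : C) != 0 by rewrite intr_eq0.
have cE : (c%:~R : C) = (box_content u b)%:~R - (box_content u a)%:~R.
  exact: rmorphB.
have wk : e *m jm k = (box_content u a)%:~R *: e.
  by rewrite we 1?ltnW // content_cat.
have wk1 : e *m jm k.+1 = (box_content u b)%:~R *: e.
  by rewrite we // content_catS box_content_rcons.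
move=> j le_jn; rewrite /intertwine mulmxBl -scalemxAl.
have [->|jk] := eqVneq j k.
  rewrite content_cat -mulmxA jmx_swl // mulmxBr mulmx1 mulmxA wk1 wk.
  rewrite -scalemxAl scalerBr !scalerA -addrA; congr (_ + _).
  rewrite -opprD -{1}[e]scale1r -scalerDl; congr (- (_ *: _)).
  by rewrite cE in cC *; field.
have [->|jk1] := eqVneq j k.+1.
  rewrite content_catS box_content_rcons // -mulmxA.
  have -> : sw k *m jm k.+1 = jm k *m sw k + 1%:M by rewrite jmx_swr // subrK.
  rewrite mulmxDr mulmx1 mulmxA wk1 wk -scalemxAl scalerBr !scalerA -addrA.
  congr (_ + _); rewrite -{1}[e]scale1r -scalerBl -scaleNr; congr (_ *: _).
  by rewrite cE in cC *; field.
have -> : content (u ++ [:: b, a & v]) j = content (u ++ [:: a, b & v]) j.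
  case: (ltnP j k) => [ju|kj]; first by rewrite !content_catl.
  have cat2 x y : u ++ x :: y :: v = (u ++ [:: x; y]) ++ v by rewrite -catA.
  rewrite !cat2.
  apply: content_perm; first exact: perm_swap.
  by rewrite size_cat /= -/k; lia.
by rewrite -mulmxA -jmx_swC // mulmxA we // -scalemxAl scalerBr !scalerA mulrC.
Qed.

(** The content of [b] is taken after [a] was added, which also covers boxes adjacent in a row or
    column; there [c] is 1 or -1 and the form vanishes. *)
Lemma intertwine_form H u a b v e
    (c := (box_content (rcons u a) b - box_content u a)%R) :
    (size u < n)%N -> c != 0 -> weight_vector (u ++ a :: b :: v) e ->
    (forall i j, (i <= (size u).+1)%N -> (j <= (size u).+1)%N ->
       tr i j *m H = H *m tr i j) ->
  sform H (intertwine (size u) c e) (intertwine (size u) c e) =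
  (1 - c%:~R ^- 2) * sform H e e.
Proof.
move=> lt_un c0 we HC; set k := size u.
have cC : (c%:~R : C) != 0 by rewrite intr_eq0.
have wk : e *m jm k = (box_content u a)%:~R *: e.
  by rewrite we 1?ltnW // content_cat.
have wk1 : e *m jm k.+1 = (box_content (rcons u a) b)%:~R *: e.
  by rewrite we // content_catS.
have iC (i : int) : (i%:~R : C)^* = i%:~R by rewrite rmorph_int.
(* Evaluate [jm (size u)] between [e] and [e *m sw k] on both sides, using the Hecke relation on one
   of them. *)
have hS : sform H e (e *m sw k) = c%:~R^-1 * sform H e e.
  apply: (mulfI cC); rewrite mulrA mulfV // mul1r.
  have : sform H e (e *m (sw k *m jm k)) = sform H (e *m jm k) (e *m sw k).
    rewrite mulmxA sform_adj ?jmx_herm // /jmx /trsum mulmx_suml mulmx_sumr.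
    by rewrite !big_nat; apply: eq_bigr => i ?; apply: HC; lia.
  rewrite jmx_swl // mulmxBr mulmx1 mulmxA wk1 wk -scalemxAl sformBr sformZr.
  rewrite sformZl iC => h.
  by rewrite [c%:~R]rmorphB /= mulrBl -h opprB addrC subrK.
have hSS : sform H (e *m sw k) (e *m sw k) = sform H e e.
  by rewrite sform_adj ?trmx_of_herm ?HC -?mulmxA ?trmx_ofK ?mulmx1 //; lia.
have hSl : sform H (e *m sw k) e = sform H e (e *m sw k).
  by rewrite sform_adj ?trmx_of_herm ?HC //; lia.
rewrite /intertwine sformBl !sformBr !sformZl !sformZr hSS hSl hS.
by rewrite fmorphV /= iC -exprVn; ring.
Qed.

End WeightVectors.

(* [(arm_leg c r i).+1] is the hook length of the box of row [i] in the column of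
   the last box of row [r], when the rows have lengths [c] and that box is
   removable. *)
Definition arm_leg (c : nat -> nat) r i := (c i - c r + (r - i))%N.

Definition hook_ratio (F : fieldType) (c : nat -> nat) r : F :=
  \prod_(0 <= i < r) ((arm_leg c r i).+1%:R / (arm_leg c r i)%:R).

(** * Bounds for tableaux and decomposition over standard tableaux *)

Section IsotypicBound.
Variables (C : numClosedFieldType) (n m : nat).
Variable rG : mx_representation C (symS n.+1) m.
Hypothesis rGU : forall g, (rG g) ^t* = rG g^-1%g.
Local Notation tr := (trmx_of rG).
Local Notation jm := (jmx rG).
Local Notation sw k := (tr k k.+1).
Local Notation antisym := (antisym rG).
Local Notation weight_vector := (weight_vector rG).
Implicit Types (w : seq nat) (e : 'rV[C]_m) (H : 'M[C]_m).

Let oC i j : tr i j *m 1%:M = 1%:M *m tr i j.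
Proof. by rewrite mulmx1 mul1mx. Qed.

Section Bound.
Variable P : 'M[C]_m.
Hypotheses (hP : P ^t* = P) (PP : P *m P = P).
Hypothesis PC : forall i j, (i < n)%N -> (j < n)%N -> tr i j *m P = P *m tr i j.
Hypothesis P_antisym : forall q v, (q <= n)%N -> antisym q n.+1 v ->
  (n.+1 - q)%:R * sform P v v <= sform 1%:M v v.

Lemma sform_ge0 e : 0 <= sform P e e.
Proof. by rewrite sform_proj // sform1_ge0. Qed.

Lemma count_lattice_iota u r i : (i <= r)%N ->
  count_mem i (u ++ iota 0 r.+1) = (count_mem i u).+1.
Proof.
move=> le_ir; rewrite count_cat (count_uniq_mem _ (iota_uniq _ _)) mem_iota.
by rewrite add0n ltnS le_ir addn1.
Qed.

Lemma column_bound u r e : size (u ++ iota 0 r.+1) = n.+1 ->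
    lattice (u ++ iota 0 r.+1) -> weight_vector (u ++ iota 0 r.+1) e ->
  hook_ratio C (fun i => count_mem i (u ++ iota 0 r.+1)) r * sform P e e
    <= sform 1%:M e e.
Proof.
set w := u ++ _ => sw lw we; pose x k : C := (content w k)%:~R.
have xE i : (i <= r)%N -> content w (size u + i) = (count_mem i u)%:Z - i%:Z.
  move=> le_ir; have -> : w = (u ++ iota 0 i) ++ i :: iota i.+1 (r - i).
    rewrite /w; have -> : r.+1 = (i + (r - i).+1)%N by lia.
    by rewrite iotaD -catA.
  have <- : size (u ++ iota 0 i) = (size u + i)%N by rewrite size_cat size_iota.
  rewrite content_cat /box_content count_cat.
  by rewrite (count_uniq_mem _ (iota_uniq _ _)) mem_iota ltnn andbF addn0.
have szu : n = (size u + r)%N by move: sw; rewrite size_cat size_iota; lia.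
have leu i j : (i <= j <= r)%N -> (count_mem j u <= count_mem i u)%N.
  move=> /andP[ij jr]; have := lattice_count lw ij.
  by rewrite !count_lattice_iota //; exact: leq_trans jr.
have x_decr i j : (size u <= i)%N -> (i < j <= n)%N -> x j < x i.
  move=> ui ij; rewrite /x ltr_int.
  have -> : i = (size u + (i - size u))%N by lia.
  have -> : j = (size u + (j - size u))%N by lia.
  have := leu (i - size u)%N (j - size u)%N.
  rewrite !xE; lia.
have := @sform_chain_le _ _ _ _ rGU e x (size u) we _ x_decr P hP PP PC P_antisym.
have -> : chain_ratio x (size u) n =
          hook_ratio C (fun i => count_mem i w) r; last first.
  by apply; [move=> k; rewrite /x realz | lia].
have xn : x n = ((count_mem r u)%:Z - r%:Z)%:~R.
  by rewrite -xE // /x -szu.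
rewrite /chain_ratio /hook_ratio -{1}[size u]add0n big_addn.
have -> : (n - size u)%N = r by lia.
rewrite !big_nat; apply: eq_bigr => i ir; rewrite addnC xn /x.
have le_ir : (i <= r)%N by lia.
have := leu i r; rewrite xE // /arm_leg /w !count_lattice_iota // => le_c.
(* The content difference between the ends of rows [i] and [r] is arm plus leg, i.e. the hook length
   minus 1. *)
have d_eq : (count_mem i u)%:Z - i%:Z - ((count_mem r u)%:Z - r%:Z) =
    ((count_mem i u).+1 - (count_mem r u).+1 + (r - i))%N%:Z by lia.
rewrite -!rmorphB /= d_eq -[1 : C]/(1%:~R) -rmorphD /=.
by rewrite -!pmulrn addn1.
Qed.

(** An exchange multiplies the forms of [P] and of the identity by the same positive number
    [1 - c%:~R ^- 2]. As [t] is not empty, the exchanged letters are below [n] and commute with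
    [P]. *)
Lemma reach_bound (K : C) (t w w' : seq nat) : reach w w' -> t != [::] ->
    size (w ++ t) = n.+1 ->
    (forall e, weight_vector (w' ++ t) e -> K * sform P e e <= sform 1%:M e e) ->
  forall e, weight_vector (w ++ t) e -> K * sform P e e <= sform 1%:M e e.
Proof.
move=> rww' t0; elim: rww' => // u a b v {}w' lu ua uab ab ub uba hc _ IH sz hw e.
rewrite -catA => we; have st : (0 < size t)%N by case: t t0 {IH sz hw we}.
have lt_un : ((size u).+1 < n)%N by move: sz; rewrite !size_cat /=; lia.
pose c := box_content u b - box_content u a.
have c0 : c != 0 by apply: contraTneq hc; rewrite -/c => ->.
have hb := box_content_rcons u ab.
have hf H : (forall i j, (i < n)%N -> (j < n)%N -> tr i j *m H = H *m tr i j) ->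
    sform H (intertwine rG (size u) c e) (intertwine rG (size u) c e) =
    (1 - c%:~R ^- 2) * sform H e e.
  move=> HC; rewrite /c -hb (intertwine_form rGU _ _ we) ?hb -/c //; first lia.
  by move=> i j ? ?; apply: HC; lia.
have := IH _ hw (intertwine rG (size u) c e); rewrite -catA.
have c2 : 0 < 1 - (c%:~R ^- 2 : C).
  rewrite subr_gt0 invf_lt1 -?rmorphXn /= ?ltr1z ?ltr0z.
  by move: hc; rewrite -/c; nia.
  by move: hc; rewrite -/c; nia.
rewrite !hf ?(mulrCA K) ?ler_pM2l //; apply.
- by move: sz; rewrite !size_cat /=; lia.
- by apply: (@intertwine_weight _ _ _ rG u a b (v ++ t)) => //; lia.
Qed.

Lemma weight_bound w r e : lattice (rcons w r) -> size w = n ->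
    weight_vector (rcons w r) e ->
  hook_ratio C (fun i => count_mem i (rcons w r)) r * sform P e e
    <= sform 1%:M e e.
Proof.
move=> lw sw; have [w' hw'] := reach_column lw; have hw := reach_cat [:: r] hw'.
have eq_w : (w' ++ iota 0 r) ++ [:: r] = w' ++ iota 0 r.+1.
  by rewrite -catA -(addn1 r) iotaD.
rewrite -cats1; apply: (reach_bound hw') => //; first by rewrite size_cat sw addn1.
move=> e'; rewrite eq_w in hw *; move=> we'.
have -> : hook_ratio C (fun i => count_mem i (w ++ [:: r])) r =
          hook_ratio C (fun i => count_mem i (w' ++ iota 0 r.+1)) r.
  by apply: eq_bigr => i _; rewrite /arm_leg !(seq.permP (reach_perm hw)).
apply: column_bound => //; last by rewrite cats1 in hw; apply: reach_lattice hw lw.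
by rewrite -(perm_size (reach_perm hw)) size_cat sw addn1.
Qed.

End Bound.

Variable w0 : seq nat.
Hypothesis size_w0 : size w0 = n.+1.

Definition standard_words := [seq w <- permutations w0 | lattice w].

Lemma mem_standard w : (w \in standard_words) = lattice w && perm_eq w w0.
Proof. by rewrite mem_filter mem_permutations. Qed.

Lemma standard_size w : w \in standard_words -> size w = n.+1.
Proof. by rewrite mem_standard => /andP[_ /perm_size->]. Qed.

(** Membership in the span of the weight vectors of standard tableaux; a tableau that does not occur
    is given the weight vector 0. *)
Definition weight_sum e := exists phi : seq nat -> 'rV[C]_m,
  (forall w, weight_vector w (phi w)) /\ e = \sum_(w <- standard_words) phi w.

Lemma weight_vectorD w e1 e2 : weight_vector w e1 -> weight_vector w e2 ->
  weight_vector w (e1 + e2).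
Proof. by move=> h1 h2 k le_k; rewrite mulmxDl h1 // h2 // scalerDr. Qed.

Lemma weight_vectorZ w a e : weight_vector w e -> weight_vector w (a *: e).
Proof. by move=> h k le_k; rewrite -scalemxAl h // !scalerA mulrC. Qed.

Lemma weight_vector0 w : weight_vector w 0.
Proof. by move=> k le_k; rewrite mul0mx scaler0. Qed.

Lemma weight_sum0 : weight_sum 0.
Proof.
exists (fun=> 0); split=> [w|]; [exact: weight_vector0 | by rewrite big1].
Qed.

Lemma weight_sumD e1 e2 : weight_sum e1 -> weight_sum e2 -> weight_sum (e1 + e2).
Proof.
move=> [f1 [h1 ->]] [f2 [h2 ->]]; exists (fun w => f1 w + f2 w).
by split=> [w|]; [apply: weight_vectorD | rewrite big_split].
Qed.

Lemma weight_sumZ a e : weight_sum e -> weight_sum (a *: e).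
Proof.
move=> [f [h ->]]; exists (fun w => a *: f w).
by split=> [w|]; [apply: weight_vectorZ | rewrite scaler_sumr].
Qed.

Lemma weight_sum_sum I (r : seq I) (Q : pred I) (E : I -> 'rV[C]_m) :
  (forall i, Q i -> weight_sum (E i)) -> weight_sum (\sum_(i <- r | Q i) E i).
Proof.
by move=> h; apply: big_ind => //; [exact: weight_sum0|exact: weight_sumD].
Qed.

Lemma weight_sum1 w e : w \in standard_words -> weight_vector w e -> weight_sum e.
Proof.
move=> w_std we; exists (fun x => if x == w then e else 0); split=> [x|].
  by case: eqP => [->|_] //; apply: weight_vector0.
rewrite -big_mkcond (big_rem w) //= eqxx big1_seq ?addr0 // => x /andP[/eqP->].
by rewrite mem_rem_uniq ?filter_uniq ?permutations_uniq // inE eqxx.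
Qed.

Lemma split_two w k : (k.+1 < size w)%N ->
  w = take k w ++ nth 0%N w k :: nth 0%N w k.+1 :: drop k.+2 w.
Proof.
by move=> lt_k; rewrite -!drop_nth ?cat_take_drop // ltnW.
Qed.

(** On a weight vector, [sw k] gives the intertwined vector plus a multiple of the vector itself.
    The former vanishes for adjacent boxes and otherwise belongs to the exchanged standard
    tableau. *)
Lemma weight_sum_sw k e : (k < n)%N -> weight_sum e -> weight_sum (e *m sw k).
Proof.
move=> lt_kn [phi [hphi ->]]; rewrite mulmx_suml big_seq; apply: weight_sum_sum.
move=> w w_std; move: (phi w) (hphi w) => {}e we.
have sz := standard_size w_std; have lt_k : (k.+1 < size w)%N by rewrite sz.
have e_std : weight_sum e := weight_sum1 w_std we.
move: w_std (w_std); rewrite {1}mem_standard => /andP[lw perm_w] w_std.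
have := split_two lt_k; set u := take k w; set a := nth _ _ _.
set b := nth _ _ _; set v := drop _ _ => def_w.
have su : size u = k by rewrite size_takel // 2?ltnW.
move: (lw); rewrite def_w /lattice lattice_from_cat /= => /and4P[lu ua uab _].
pose c := box_content (rcons u a) b - box_content u a.
have eE : e *m sw k = intertwine rG k c e + c%:~R^-1 *: e by rewrite subrK.
have hE : c != 0 -> sform 1%:M (intertwine rG k c e) (intertwine rG k c e) =
    (1 - c%:~R ^- 2) * sform 1%:M e e.
  move=> c0; rewrite -su (intertwine_form rGU _ _ (v := v)) // ?su -?def_w //.
(* For adjacent boxes the exchanged vector has norm [1 - c ^- 2 = 0]. *)
have h1 : (c == 1) || (c == -1) -> weight_sum (e *m sw k).
  move=> c1; have c0 : c != 0 by lia.
  have /sform1_eq0 i0 : sform 1%:M (intertwine rG k c e) (intertwine rG k c e) = 0.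
    rewrite hE // -rmorphXn /=; have -> : c ^+ 2 = 1 by case/orP: c1 => /eqP->.
    by rewrite invr1 subrr mul0r.
  by rewrite eE i0 add0r; apply: weight_sumZ.
case: (lattice_swapP lu ua uab) => [[_ hc]|[_ hc]|[ab ub uba hc]].
- by apply: h1; rewrite /c hc; lia.
- by apply: h1; rewrite /c hc; lia.
rewrite eE; apply: weight_sumD; last exact: weight_sumZ.
apply: (@weight_sum1 (u ++ b :: a :: v)).
  rewrite mem_standard (lattice_swap ub uba) -?def_w //=.
  by rewrite -(permPl (perm_swap u a b v)) -def_w.
rewrite /c box_content_rcons // -su.
apply: intertwine_weight; rewrite ?su -?def_w //.
by lia.
Qed.

Lemma weight_sum_tr i j e : (i <= n)%N -> (j <= n)%N ->
  weight_sum e -> weight_sum (e *m tr i j).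
Proof.
move=> le_in le_jn; wlog le_ij : i j le_in le_jn / (i <= j)%N => [hw|].
  by case: (leqP i j) => [ij|/ltnW ij]; [|rewrite trmx_ofC]; apply: hw.
elim: j le_jn le_ij e => [|j IHj] le_jn le_ij e we.
  have -> : i = 0%N by lia.
  by rewrite /trmx_of tperm1 repr_mx1 mulmx1.
have [->|ij] := eqVneq i j.+1; first by rewrite /trmx_of tperm1 repr_mx1 mulmx1.
have [->|ij'] := eqVneq i j; first by apply: weight_sum_sw => //; lia.
have -> : tr i j.+1 = sw j *m tr i j *m sw j.
  by rewrite -mulmxA trmx_of_braid; [rewrite mulmxA trmx_ofK mul1mx|lia..].
rewrite !mulmxA; apply: weight_sum_sw => //; apply: IHj; try lia.
exact: weight_sum_sw.
Qed.

Lemma weight_sum_repr g e : weight_sum e -> weight_sum (e *m rG g).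
Proof.
have [ts -> _] := prod_tpermP g.
elim: ts e => [|t ts IH] e we; first by rewrite big_nil repr_mx1 mulmx1.
rewrite big_cons repr_symM mulmxA; apply: IH.
have := weight_sum_tr (ltn_ord t.1 : t.1 <= n)%N (ltn_ord t.2 : t.2 <= n)%N we.
by rewrite /trmx_of !inord_val.
Qed.

(** The contents differ at some [k < n], and [jm k] is self-adjoint for [H] because it involves only
    letters below [n]. *)
Lemma weight_orthogonal H w1 w2 e1 e2 :
    (forall i j, (i < n)%N -> (j < n)%N -> tr i j *m H = H *m tr i j) ->
    w1 \in standard_words -> w2 \in standard_words -> w1 != w2 ->
    weight_vector w1 e1 -> weight_vector w2 e2 -> sform H e1 e2 = 0.
Proof.
move=> HC std1 std2 ne12 we1 we2; have sz := standard_size std1.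
move: std1 std2; rewrite !mem_standard => /andP[l1 p1] /andP[l2 p2].
have p12 : perm_eq w1 w2 by rewrite (permPl p1) perm_sym.
have [k lt_k ne_k] := lattice_content_inj l1 l2 p12 ne12.
have lt_kn : (k < n)%N by move: lt_k; rewrite sz.
have : sform H (e1 *m jm k) e2 = sform H e1 (e2 *m jm k).
  rewrite sform_adj ?jmx_herm // /jmx /trsum mulmx_suml mulmx_sumr.
  by rewrite !big_nat; apply: eq_bigr => i ?; apply: HC; lia.
rewrite we1 1?ltnW // we2 1?ltnW // sformZl sformZr rmorph_int => /eqP.
rewrite -subr_eq0 -mulrBl -rmorphB /= mulf_eq0 intr_eq0 subr_eq0 (negPf ne_k).
by move/eqP.
Qed.

(** By orthogonality both forms are sums over the standard tableaux, so the bound follows tableau by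
    tableau. *)
Lemma weight_sum_bound (K : C) (P : 'M[C]_m) e : P ^t* = P -> P *m P = P ->
    (forall i j, (i < n)%N -> (j < n)%N -> tr i j *m P = P *m tr i j) ->
    (forall q v, (q <= n)%N -> antisym q n.+1 v ->
       (n.+1 - q)%:R * sform P v v <= sform 1%:M v v) ->
    (forall w, w \in standard_words ->
       K <= hook_ratio C (fun i => count_mem i w0) (last 0%N w)) ->
  weight_sum e -> K * sform P e e <= sform 1%:M e e.
Proof.
move=> hP PP PC P_anti hK [phi [hphi ->]].
have diag H : (forall i j, (i < n)%N -> (j < n)%N -> tr i j *m H = H *m tr i j) ->
    sform H (\sum_(w <- standard_words) phi w) (\sum_(w <- standard_words) phi w)
    = \sum_(w <- standard_words) sform H (phi w) (phi w).
  move=> HC; rewrite sform_suml; apply: eq_big_seq => w std_w.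
  rewrite sform_sumr (bigD1_seq w) ?filter_uniq ?permutations_uniq //=.
  rewrite big1_seq ?addr0 //.
  move=> w' /andP[ne_w std_w']; apply: weight_orthogonal (hphi w) (hphi w') => //.
  by rewrite eq_sym.
rewrite !diag // mulr_sumr !big_seq; apply: ler_sum => w std_w.
apply: le_trans (_ : hook_ratio C (fun i => count_mem i w0) (last 0%N w) *
   sform P (phi w) (phi w) <= _); first by rewrite ler_wpM2r ?hK ?sform_ge0.
have sz := standard_size std_w; move: std_w (hphi w); rewrite mem_standard.
case/lastP: w sz => [//|w r]; rewrite size_rcons last_rcons => -[sz] /andP[lw pw] we.
have -> : hook_ratio C (fun i => count_mem i w0) r =
          hook_ratio C (fun i => count_mem i (rcons w r)) r.
  by apply: eq_bigr => i _; rewrite /arm_leg !(seq.permP pw).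
exact: weight_bound.
Qed.

End IsotypicBound.

(** * Projections in one tensor factor *)

Lemma eq_mulmxl (R : pzRingType) k m (A B : 'M[R]_(k, m)) :
  (forall u : 'rV_k, u *m A = u *m B) -> A = B.
Proof. by move=> h; apply/row_matrixP => i; rewrite !rowE h. Qed.

Section TensorProjections.
Variables (C : numClosedFieldType) (n d : nat).
Local Notation basis := (tbasis n.+1 d).
Local Notation rG := (tensor_perm_repr C n.+1 d).
Local Notation tr := (trmx_of rG).
Implicit Types (u a : 'rV[C]_#|basis|) (x y : basis) (i j k : 'I_n.+1).

Lemma tensor_perm_unitary g : (rG g) ^t* = rG g^-1%g.
Proof.
apply/matrixP => r s; rewrite !mxE rmorph_nat; congr (nat_of_bool _)%:R.
apply/eqP/eqP => [->|->]; apply/ffunP => k; rewrite !ffunE invgK.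
  by rewrite permK.
by rewrite permKV.
Qed.

Definition tcoord u x : C := u 0 (enum_rank x).

Lemma eq_tcoord u w : (forall x, tcoord u x = tcoord w x) -> u = w.
Proof.
move=> h; apply/rowP => r; have := h (enum_val r).
by rewrite /tcoord enum_valK.
Qed.

Lemma tcoordN u x : tcoord (- u) x = - tcoord u x.
Proof. by rewrite /tcoord mxE. Qed.

Lemma tcoord_perm u g y : tcoord (u *m rG g) y = tcoord u (permute_factors g^-1%g y).
Proof.
rewrite /tcoord mxE (bigD1 (enum_rank (permute_factors g^-1%g y))) //=.
rewrite mxE !enum_rankK big1 => [|r ne_r].
  have -> : permute_factors g (permute_factors g^-1%g y) = y.
    by apply/ffunP => k; rewrite !ffunE invgK permKV.
  by rewrite eqxx mulr1 addr0.
rewrite mxE enum_rankK; case: (y =P _) ne_r => [->|_ _]; last by rewrite mulr0.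
have -> : permute_factors g^-1%g (permute_factors g (enum_val r)) = enum_val r.
  by apply/ffunP => k; rewrite !ffunE invgK permK.
by rewrite enum_valK eqxx.
Qed.

Variable v : 'I_d -> C.
Hypothesis v_norm : \sum_c v c * (v c)^* = 1.

(** Since matrices act on row vectors from the right, the image in factor [i] is the line of the
    conjugate of [v]. *)
Definition factor_proj i : 'M[C]_#|basis| := \matrix_(r, s)
  let x : basis := enum_val r in let y : basis := enum_val s in
  [forall k, (k != i) ==> (x k == y k)]%:R * (v (x i) * (v (y i))^*).

Definition update y i (c : 'I_d) : basis := [ffun k => if k == i then c else y k].

Lemma tcoord_proj u i y :
  tcoord (u *m factor_proj i) y = (v (y i))^* * \sum_c v c * tcoord u (update y i c).
Proof.
rewrite /tcoord mxE mulr_sumr.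
rewrite (partition_big (fun r => (enum_val r : basis) i) predT) //=.
apply: eq_bigr => c _.
rewrite (bigD1 (enum_rank (update y i c))) /=; last by rewrite enum_rankK ffunE eqxx.
rewrite mxE /= !enum_rankK big1 => [|r /andP[/eqP rc ne_r]].
  have -> : [forall k, (k != i) ==> (update y i c k == y k)].
    by apply/forallP => k; apply/implyP => /negPf ki; rewrite ffunE ki.
  by rewrite ffunE eqxx mul1r addr0 mulrC -mulrA mulrCA.
rewrite mxE /= enum_rankK; case: forallP => [h|]; last by rewrite mulr0n mul0r mulr0.
case/eqP: ne_r; rewrite -[r]enum_valK; congr enum_rank; apply/ffunP => k.
by rewrite ffunE; have := h k; case: eqP => [->|_ /= /eqP].
Qed.

Lemma factor_proj_herm i : (factor_proj i) ^t* = factor_proj i.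
Proof.
apply/matrixP => r s; rewrite !mxE /= !rmorphM rmorph_nat /= conjCK.
congr (_ * _); last exact: mulrC.
by congr (nat_of_bool _)%:R; apply: eq_forallb => k; congr (_ ==> _); exact: eq_sym.
Qed.

Lemma factor_projK i : factor_proj i *m factor_proj i = factor_proj i.
Proof.
apply: eq_mulmxl => u; rewrite mulmxA; apply: eq_tcoord => y; rewrite !tcoord_proj.
congr (_ * _).
rewrite -[RHS]mul1r -v_norm mulr_suml; apply: eq_bigr => c _.
rewrite tcoord_proj ffunE eqxx mulrA; congr (_ * _); apply: eq_bigr => e _.
by congr (_ * tcoord u _); apply/ffunP => k; rewrite !ffunE; case: eqP.
Qed.

Lemma perm_factor_proj g i : rG g *m factor_proj (g i) = factor_proj i *m rG g.
Proof.
apply: eq_mulmxl => u; rewrite !mulmxA; apply: eq_tcoord => y.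
rewrite tcoord_proj !tcoord_perm tcoord_proj ffunE invgK; congr (_ * _).
apply: eq_bigr => c _; rewrite tcoord_perm; congr (_ * tcoord u _).
by apply/ffunP => k; rewrite !ffunE invgK (inj_eq perm_inj).
Qed.

(** Both factors are contracted with the same vector, and the symmetric weights [v c * v e]
    annihilate an antisymmetric tensor: the double sum equals its own negative. *)
Lemma factor_proj_antisym a i j : i != j -> a *m rG (tperm i j) = - a ->
  a *m factor_proj i *m factor_proj j = 0.
Proof.
move=> ij ha; apply: eq_tcoord => y; rewrite tcoord_proj.
under eq_bigr => c _ do rewrite tcoord_proj ffunE (negPf ij).
set S := \sum_c _; suff -> : S = 0 by rewrite mulr0 /tcoord mxE.
pose T c e := v c * v e * tcoord a (update (update y j c) i e).
have -> : S = (v (y i))^* * \sum_c \sum_e T c e.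
  rewrite mulr_sumr; apply: eq_bigr => c _; rewrite mulrCA; congr (_ * _).
  by rewrite mulr_sumr; apply: eq_bigr => e _; rewrite mulrA.
suff h : \sum_c \sum_e T c e = - \sum_c \sum_e T c e.
  have /eqP : (\sum_c \sum_e T c e) *+ 2 = 0 by rewrite mulr2n {1}h addNr.
  by rewrite mulrn_eq0 /= => /eqP->; rewrite mulr0.
rewrite {1}exchange_big -sumrN; apply: eq_bigr => c _; rewrite -sumrN.
apply: eq_bigr => e _; rewrite /T [v e * v c]mulrC -mulrN; congr (_ * _).
rewrite -tcoordN -ha tcoord_perm; congr tcoord; apply/ffunP => k.
rewrite !ffunE !tpermV; case: tpermP => [->|->|/eqP ki /eqP kj].
- by rewrite eqxx [j == i]eq_sym (negPf ij) eqxx.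
- by rewrite eqxx [j == i]eq_sym (negPf ij) eqxx.
by rewrite (negPf ki) (negPf kj).
Qed.

Lemma factor_proj_comm (i j : nat) : (i < n)%N -> (j < n)%N ->
  tr i j *m factor_proj ord_max = factor_proj ord_max *m tr i j.
Proof.
move=> lt_in lt_jn; rewrite /trmx_of -perm_factor_proj tpermD //.
  by rewrite -val_eqE /= inordK; lia.
by rewrite -val_eqE /= inordK; lia.
Qed.

(** Bessel's inequality: the vectors [a *m Q k] are mutually orthogonal and, by antisymmetry, all
    have norm [sform P a a]; the bound is the positivity of the norm of [a - S]. *)
Lemma factor_proj_bound q a : (q <= n)%N -> antisym rG q n.+1 a ->
  (n.+1 - q)%:R * sform (factor_proj ord_max) a a <= sform 1%:M a a.
Proof.
move=> le_qn ha; set P := factor_proj ord_max.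
pose Q (k : nat) := factor_proj (inord k).
have oC (A : 'M[C]_#|basis|) : A *m 1%:M = 1%:M *m A by rewrite mulmx1 mul1mx.
have Qn : Q n = P by congr factor_proj; apply: val_inj; rewrite /= inordK.
have hQ (k : nat) : (q <= k < n.+1)%N -> sform 1%:M (a *m Q k) a = sform P a a.
  move=> /andP[qk kn]; have -> : sform 1%:M (a *m Q k) a = sform (Q k) a a.
    by rewrite /sform mulmx1.
  have [->|ne_kn] := eqVneq k n; first by rewrite Qn.
  have tP : tr k n *m P = Q k *m tr k n.
    by rewrite -Qn /Q -perm_factor_proj tpermL.
  have hak : a *m tr k n = - a by apply: ha; lia.
  rewrite -[RHS]opprK -sformNl -sformNr -hak.
  rewrite /sform trmx_mul map_mxM trmx_of_herm; last exact: tensor_perm_unitary.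
  rewrite -[a *m _ *m P]mulmxA tP !mulmxA -[_ *m tr k n *m tr k n]mulmxA.
  by rewrite trmx_ofK mulmx1.
have hQQ (k l : nat) : (q <= k < n.+1)%N -> (q <= l < n.+1)%N ->
    sform 1%:M (a *m Q k) (a *m Q l) = if l == k then sform P a a else 0.
  move=> hk hl; rewrite -sform_adj ?factor_proj_herm ?oC //.
  have [->|kl] := eqVneq l k; first by rewrite -mulmxA factor_projK hQ.
  rewrite factor_proj_antisym ?sform0l //; last by apply: ha; lia.
  by rewrite inord_eq //; lia.
pose S := \sum_(q <= k < n.+1) a *m Q k.
have haS : sform 1%:M S a = (n.+1 - q)%:R * sform P a a.
  by rewrite sform_suml big_nat (eq_bigr _ hQ) -big_nat sumr_const_nat mulr_natl.
have hSa : sform 1%:M a S = (n.+1 - q)%:R * sform P a a.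
  rewrite sform_sumr -haS sform_suml; apply: eq_bigr => k _.
  by rewrite sform_adj ?factor_proj_herm ?oC.
have hSS : sform 1%:M S S = (n.+1 - q)%:R * sform P a a.
  rewrite -haS {1 3}/S !sform_suml !big_nat; apply: eq_bigr => k hk.
  rewrite sform_sumr big_nat (eq_bigr _ (fun l => hQQ k l hk)) -big_nat.
  by rewrite -big_mkcond big_nat1_eq hk hQ.
have := sform1_ge0 (a - S).
by rewrite sformBl !sformBr hSS hSa haS subrr subr0 subr_ge0.
Qed.

End TensorProjections.

(** * The Young symmetrizer *)

Section RowWord.
Local Open Scope nat_scope.
Implicit Types (nu : seq nat).

Fixpoint row_word s nu :=
  if nu is x :: nu' then nseq x s ++ row_word s.+1 nu' else [::].

(** Identifies the lattice word with the tableau that underlies [young_symmetrizer]. *)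
Lemma row_wordE nu : row_word 0 nu = map (reshape_index nu) (iota 0 (sumn nu)).
Proof.
suff h s : row_word s nu = map (addn s \o reshape_index nu) (iota 0 (sumn nu)).
  by rewrite h; apply: eq_map.
elim: nu s => //= x nu IHnu s; rewrite iotaD map_cat; congr (_ ++ _).
  transitivity [seq s | _ <- iota 0 x].
    by elim: x 0 => //= y IHy k; rewrite -IHy.
  apply/eq_in_map => i; rewrite mem_iota /= /reshape_index /= => lt_ix.
  by rewrite (eqP lt_ix) addn0.
rewrite IHnu [0 + x]addnC iotaDl -map_comp; apply: eq_map => i /=.
by rewrite /reshape_index /= subSn ?leq_addr // addKn addSnnS.
Qed.

Lemma count_row_word s nu j :
  count_mem (s + j) (row_word s nu) = nth 0 nu j /\
  forall i, i < s -> count_mem i (row_word s nu) = 0.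
Proof.
elim: nu s j => [|x nu IHnu] s j /=; first by rewrite nth_nil.
split=> [|i lt_is]; rewrite count_cat count_nseq.
  case: j => [|j] /=; last by rewrite -addSnnS (IHnu _ _).1; case: eqP; lia.
  by rewrite addn0 eqxx mul1n (IHnu s.+1 0).2 ?addn0.
by rewrite (IHnu s.+1 0).2 1?ltnW //= gtn_eqF.
Qed.

Lemma lattice_row_word nu : sorted geq nu -> lattice (row_word 0 nu).
Proof.
(* Generalized to a prefix [u] that has no letter from row [s] on and whose row [s.-1] is long
   enough to carry the next row. *)
suff h s u : (forall j, s <= j -> count_mem j u = 0) ->
    s = 0 \/ head 0 nu <= count_mem s.-1 u -> sorted geq nu ->
    lattice_from u (row_word s nu) by apply: h => //; left.
elim: nu s u => //= x nu IHnu s u hu hs nu_sorted.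
have hc y : y <= x -> lattice_from u (nseq y s).
  elim: y => // y IHy lt_yx; rewrite -[y.+1]addn1 nseqD lattice_from_cat.
  rewrite IHy 1?ltnW //= andbT /addable !count_cat !count_nseq /= eqxx hu //.
  case: hs => [->|le_x] //; case: s hu IHy le_x => //= s hu IHy le_x.
  rewrite mul1n; lia.
rewrite lattice_from_cat hc //= IHnu //; last exact: path_sorted nu_sorted.
  by move=> j lt_sj; rewrite count_cat count_nseq hu 1?ltnW //= ltn_eqF.
right; rewrite /= count_cat count_nseq /= eqxx mul1n.
case: nu nu_sorted {IHnu} => //= y nu /andP[le_yx _].
exact: leq_trans le_yx (leq_addl _ _).
Qed.

End RowWord.

Lemma sum_lt_partition (V : nmodType) (I : finType) (f : I -> nat) r (E : I -> V) :
  \sum_(i | (f i < r)%N) E i = \sum_(0 <= j < r) \sum_(i | f i == j) E i.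
Proof.
elim: r => [|r IHr]; first by rewrite big_geq // big_pred0.
rewrite big_nat_recr //= -IHr (bigID (fun i => (f i < r)%N)) /=.
by congr (_ + _); apply: eq_bigl => i; lia.
Qed.

(** * Garnir relations and the contents of the row-reading tableau *)

Section YoungSymmetrizer.
Variables (C : numClosedFieldType) (n m : nat).
Variable rG : mx_representation C (symS n.+1) m.
Variable nu : seq nat.
Hypotheses (nu_sorted : sorted geq nu) (nu_sum : sumn nu = n.+1).
Local Notation ri := (reshape_index nu).
Local Notation co := (reshape_offset nu).
Local Notation tr := (trmx_of rG).
Implicit Types (i j k x : 'I_n.+1) (p q : 'S_n.+1).

Definition row_sum : 'M[C]_m := \sum_(p in row_stab nu n.+1) rG p.
Definition col_sum : 'M[C]_m :=
  \sum_(q in col_stab nu n.+1) (-1) ^+ odd_perm q *: rG q.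

Lemma row_stabP p : reflect (forall k, ri (p k) = ri k) (p \in row_stab nu n.+1).
Proof. by rewrite inE; apply: (iffP forallP) => h k; apply/eqP. Qed.

Lemma col_stabP p : reflect (forall k, co (p k) = co k) (p \in col_stab nu n.+1).
Proof. by rewrite inE; apply: (iffP forallP) => h k; apply/eqP. Qed.

Lemma row_sum_tr i k : ri i = ri k -> row_sum *m rG (tperm i k) = row_sum.
Proof.
move=> rik; rewrite /row_sum mulmx_suml [RHS](reindex_inj (mulIg (tperm i k))) /=.
apply: eq_big => [p|p _]; last by rewrite repr_symM.
have ht x : ri (tperm i k x) = ri x by case: tpermP => [->|->|].
by apply/row_stabP/row_stabP => h x; have := h x; rewrite permM ht.
Qed.

Lemma col_sum_tr i k : i != k -> co i = co k ->
  col_sum *m rG (tperm i k) = - col_sum.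
Proof.
move=> ik cik; rewrite /col_sum mulmx_suml -sumrN.
rewrite [RHS](reindex_inj (mulIg (tperm i k))) /=.
apply: eq_big => [p|p _]; last first.
  rewrite odd_permM odd_tperm ik addbT signrN -scaleNr opprK repr_symM.
  by rewrite -scalemxAl.
have ht x : co (tperm i k x) = co x by case: tpermP => [->|->|].
by apply/col_stabP/col_stabP => h x; have := h x; rewrite permM ht.
Qed.

Section Garnir.
Variables (k : 'I_n.+1) (rho : nat).
Hypothesis lt_rho : (rho < ri k)%N.

Let inrow i := (ri i == rho) || (i == k).
Let above x : 'I_n.+1 := inord (flatten_index nu rho (co x)).

Let aboveP x : ri x = ri k -> ri (above x) = rho /\ co (above x) = co x.
Proof.
move=> rx; have lt_x : (x < sumn nu)%N by rewrite nu_sum.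
have lt_co : (co x < nth 0 nu rho)%N.
  apply: leq_trans (reshape_offsetP lt_x) _; rewrite rx.
  apply: (sorted_leq_nth (leT := geq)) => //; try exact: ltnW.
  - by move=> a b c /= ba cb; apply: leq_trans cb ba.
  - exact: leqnn.
  - by rewrite inE; apply: ltn_trans lt_rho _; rewrite -rx reshape_indexP.
  - by rewrite inE -rx reshape_indexP.
have lt_f : (flatten_index nu rho (co x) < n.+1)%N.
  by have := flatten_indexP lt_co; rewrite nu_sum.
by rewrite /above inordK // flatten_indexKl // flatten_indexKr.
Qed.

(* With [k' = p^-1 k], multiplying [p * (i k)] on the left by the transposition of
   [k'] and of the entry of row [rho] in its column is an involution of these
   products, which changes the sign of the column antisymmetrizer. *)
Let swap_above p := let k' := (p^-1)%g k in tperm (above k') k'.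
Let garnir_perm (pi : 'S_n.+1 * 'I_n.+1) := (pi.1 * tperm pi.2 k)%g.
Let garnir (pi : 'S_n.+1 * 'I_n.+1) : 'S_n.+1 * 'I_n.+1 :=
  let i' := garnir_perm pi (above (pi.1^-1%g k)) in
  (swap_above pi.1 * garnir_perm pi * tperm i' k, i')%g.
Let garnir_dom (pi : 'S_n.+1 * 'I_n.+1) :=
  (pi.1 \in row_stab nu n.+1) && inrow pi.2.

Let garnirP pi : garnir_dom pi ->
  [/\ garnir_dom (garnir pi), garnir (garnir pi) = pi,
      garnir_perm (garnir pi) = (swap_above pi.1 * garnir_perm pi)%g &
      col_sum *m rG (swap_above pi.1) = - col_sum].
Proof.
case: pi => p i /andP[/= /row_stabP hp hi]; set k' := (p^-1)%g k.
have pk : p k' = k by rewrite permKV.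
have rk' : ri k' = ri k by rewrite -hp pk.
have [ra ca] := aboveP rk'; set a := above k' in ra ca *.
have ak : a != k' by apply: contraTneq lt_rho => e; rewrite -rk' -e ra ltnn.
pose g := (p * tperm i k)%g; pose i' := g a; pose t := tperm a k'.
have gE x : g x = tperm i k (p x) by rewrite permM.
have gk' : g k' = i by rewrite gE pk tpermR.
have i'i : i' != i by rewrite -gk' (inj_eq perm_inj).
pose p' := (t * g * tperm i' k)%g.
have garnirE : garnir (p, i) = (p', i') by [].
have gg : (p' * tperm i' k)%g = (t * g)%g by rewrite -mulgA tperm2 mulg1.
have p'E x : p' x = tperm i' k (g (t x)) by rewrite /p' 2!permM.
have p'k : p' k' = k by rewrite p'E tpermR tpermL.
have p'V : (p'^-1)%g k = k' by rewrite -p'k permK.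
have inrow_i' : inrow i'.
  rewrite /i' gE; case: tpermP => [_|e|_ _]; first by rewrite /inrow eqxx orbT.
    by move: lt_rho; rewrite -ra -(hp a) e ltnn.
  by rewrite /inrow hp ra eqxx.
(* [p'] still sends [k'] to [k], sends [a] into row [rho], and agrees with [p] elsewhere, except
   that the entry sent to [i] is now sent to [i'], also in row [rho]. *)
have hp' x : ri (p' x) = ri x.
  rewrite p'E; have [->|xk] := eqVneq x k'.
    by rewrite tpermR tpermL rk'.
  have [->|xa] := eqVneq x a.
    rewrite tpermL gk' ra; case: tpermP => [e|e|ne1 ne2].
    - by rewrite e eqxx in i'i.
    - move: inrow_i'; rewrite /inrow => /orP[/eqP//|/eqP e'].
      by rewrite e e' eqxx in i'i.
    - by move: hi; rewrite /inrow => /orP[/eqP//|/eqP].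
  rewrite [t x]tpermD 1?eq_sym //.
  have gx : g x != i' by rewrite (inj_eq perm_inj).
  have pxk : p x != k by rewrite -pk (inj_eq perm_inj).
  have gxE : g x = if p x == i then k else p x.
    rewrite gE; case: tpermP => [->|e|/eqP/negPf-> _ //]; first by rewrite eqxx.
    by rewrite e eqxx in pxk.
  case: tpermP => [e|e|_ ne]; first by rewrite e eqxx in gx.
    move: e; rewrite gxE; case: eqP => [e _|_ e]; last by rewrite e eqxx in pxk.
    have ik : i != k by rewrite -e.
    have i'k : i' != k by rewrite eq_sym; move: gx; rewrite gxE e eqxx.
    move: hi inrow_i'; rewrite /inrow (negPf ik) (negPf i'k) !orbF.
    by move=> /eqP hi /eqP->; rewrite -(hp x) e hi.
  by move: ne; rewrite gxE; case: eqP.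
split.
- by rewrite garnirE /garnir_dom /= inrow_i' andbT; apply/row_stabP.
- rewrite garnirE /garnir /swap_above /garnir_perm /= p'V -/a -/t gg.
  have -> : (t * g)%g a = i by rewrite permM tpermL gk'.
  by rewrite !mulgA tperm2 mul1g /g -mulgA tperm2 mulg1.
- by rewrite garnirE.
- by apply: col_sum_tr.
Qed.

(** With [i = k] included, the sum is its own negative by the involution [garnir], hence zero; the
    term [i = k] is the symmetrizer itself. *)
Lemma garnir_relation :
  col_sum *m row_sum *m \sum_(i : 'I_n.+1 | ri i == rho) rG (tperm i k)
  = - (col_sum *m row_sum).
Proof.
pose F pi := col_sum *m rG (garnir_perm pi).
have hF : \sum_(pi | garnir_dom pi) F pi = 0.
  have hS : \sum_(pi | garnir_dom pi) F pi = - \sum_(pi | garnir_dom pi) F pi.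
    rewrite {1}(reindex_onto garnir garnir) => [|pi /garnirP[]//].
    rewrite -sumrN; apply: eq_big => [pi|pi /andP[h1 /eqP h2]].
      apply/andP/idP => [[h1 /eqP h2]|/garnirP[h1 h2 _ _]]; last by rewrite h1 h2.
      by rewrite -h2; case: (garnirP h1).
    have [|_ _ h3 h4] := @garnirP pi; first by rewrite -h2; case: (garnirP h1).
    by rewrite /F h3 repr_symM mulmxA h4 mulNmx.
  have /eqP : (\sum_(pi | garnir_dom pi) F pi) *+ 2 = 0.
    by rewrite mulr2n {1}hS addNr.
  by rewrite -scaler_nat scalemx_eq0 pnatr_eq0 /= => /eqP.
apply/eqP; rewrite -addr_eq0 addrC; apply/eqP.
rewrite -[RHS]hF /garnir_dom.
rewrite -(pair_big (mem (row_stab nu n.+1)) inrow (fun p i => F (p, i))) /=.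
rewrite /row_sum mulmx_sumr mulmx_suml -big_split; apply: eq_bigr => p _ /=.
rewrite [RHS](bigD1 k) /=; last by rewrite /inrow eqxx orbT.
rewrite /F /garnir_perm /= tperm1 mulg1; congr (_ + _).
rewrite mulmx_sumr; apply: eq_big => [i|i _]; last by rewrite repr_symM mulmxA.
rewrite /inrow; have [->|] := eqVneq i k; last by rewrite orbF andbT.
by rewrite andbF; apply/negbTE; rewrite gtn_eqF.
Qed.

End Garnir.

Lemma content_row_word (k : nat) : (k <= n)%N ->
  content (row_word 0 nu) k =
  (\sum_(i < n.+1 | (i < k)%N && (ri i == ri k)) 1)%N%:Z - (ri k)%:Z.
Proof.
move=> le_kn; rewrite /content /box_content row_wordE nu_sum -map_take.
rewrite take_iota (minn_idPl _) 1?ltnW // (nth_map 0%N) ?size_iota // nth_iota //.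
rewrite add0n count_map -sum1_count.
rewrite -[X in iota 0 X]subn0 -/(index_iota 0 k) big_mkord.
pose same_row (l : nat) := ri l == ri k.
rewrite (big_ord_widen_cond n.+1 same_row (fun=> 1%N)) 1?ltnW //.
by congr (_%:Z - _); apply: eq_bigl => i; rewrite andbC.
Qed.

(** Transpositions with earlier entries of the same row are absorbed and count the column; each row
    above contributes -1 by [garnir_relation], which subtracts the row number. *)
Lemma symmetrizer_jmx (k : nat) : (k <= n)%N ->
  col_sum *m row_sum *m jmx rG k =
  (content (row_word 0 nu) k)%:~R *: (col_sum *m row_sum).
Proof.
move=> le_kn; set Y := col_sum *m row_sum; pose kk : 'I_n.+1 := inord k.
have kkE : kk = k :> nat by rewrite inordK.
have -> : jmx rG k = \sum_(i < n.+1 | (i < k)%N) rG (tperm i kk).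
  rewrite /jmx /trsum big_mkord.
  rewrite (big_ord_widen n.+1 (fun l : nat => tr l k)) 1?ltnW //.
  by apply: eq_bigr => i _; rewrite /trmx_of inord_val.
rewrite (bigID (fun i : 'I_n.+1 => ri i == ri k)) /= mulmxDr mulmx_sumr.
rewrite (eq_bigr (fun=> Y)) => [|i /andP[_ /eqP rik]]; last first.
  by rewrite -mulmxA row_sum_tr // kkE.
have -> : \sum_(i < n.+1 | (i < k)%N && (ri i != ri k)) rG (tperm i kk) =
          \sum_(i < n.+1 | (ri i < ri k)%N) rG (tperm i kk).
  apply: eq_bigl => i; have := reshape_leq nu k i; rewrite /= [(_ <= i)%N]leqNgt.
  lia.
rewrite (sum_lt_partition (fun i : 'I_n.+1 => ri i)) mulmx_sumr big_nat.
rewrite [X in _ + X](eq_bigr (fun=> - Y)) => [|r /andP[_ lt_r]]; last first.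
  by rewrite /Y garnir_relation // kkE.
rewrite -big_nat sumr_const_nat subn0 content_row_word //.
rewrite rmorphB /= scalerBl mulNrn -!pmulrn !scaler_nat; congr (_ - _).
by rewrite sumr_const sum1_card.
Qed.

End YoungSymmetrizer.

(** * From the symmetrizer to the isotypic component *)

Section Isotypic.
Variables (C : numClosedFieldType) (n m : nat).
Variable rG : mx_representation C (symS n.+1) m.
Hypothesis rGU : forall g, (rG g) ^t* = rG g^-1%g.
Variable nu : seq nat.
Hypotheses (nu_sorted : sorted geq nu) (nu_sum : sumn nu = n.+1).
Local Notation aS := (regular_repr C (symS n.+1)).
Local Notation c := (gring_row (young_symmetrizer C nu n.+1)).
Local Notation S := (specht_mx C nu n.+1).

Lemma specht_generator_jmx k : (k <= n)%N ->
  c *m jmx aS k = (content (row_word 0 nu) k)%:~R *: c.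
Proof.
move=> le_kn; rewrite -gring_row_mul -linearZ /=; congr gring_row.
exact: symmetrizer_jmx.
Qed.

Lemma row_word_standard : row_word 0 nu \in standard_words (row_word 0 nu).
Proof. by rewrite mem_standard lattice_row_word //=. Qed.

(** An isomorphism carries the symmetrizer, which generates the Specht module, to a weight vector
    generating [U]; the span of weight vectors is stable under the group. *)
Lemma rsim_weight_sum (U : 'M[C]_m) (modU : mxmodule rG U) (v : 'rV[C]_m) :
    mx_rsim (submod_repr modU) (specht_repr C nu n.+1) -> (v <= U)%MS ->
  weight_sum rG (row_word 0 nu) v.
Proof.
move=> /mx_rsim_sym[B eq_rank freeB homB] vU.
have cS : (c <= S)%MS by apply: cyclic_mx_id.
pose h (x : 'rV[C]_#|symS n.+1|) : 'rV[C]_m := val_submod (in_submod S x *m B).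
have hE x g : (x <= S)%MS -> h x *m rG g = h (x *m aS g).
  move=> xS; rewrite /h (in_submodJ (cyclic_mx_module aS c)) //.
  have -> : in_submod S x *m submod_mx (cyclic_mx_module aS c) g *m B =
            in_submod S x *m B *m submod_mx modU g.
    by rewrite -[LHS]mulmxA -[RHS]mulmxA; congr (_ *m _); exact: homB (in_setT g).
  by rewrite val_submodJ ?in_setT.
have hL : linear h.
  by move=> a x y; rewrite /h linearP /= mulmxDl -scalemxAl linearP.
have h0 : h 0 = 0 by rewrite /h linear0 mul0mx linear0.
have hZ a x : h (a *: x) = a *: h x by have := hL a x 0; rewrite h0 !addr0.
have hD x y : h (x + y) = h x + h y by have := hL 1 x y; rewrite !scale1r.
have z_std : weight_vector rG (row_word 0 nu) (h c).
  move=> k le_kn; rewrite -hZ -specht_generator_jmx //.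
  rewrite /jmx /trsum !mulmx_sumr (big_morph h hD h0).
  by apply: eq_bigr => i _; apply: hE.
(* [B] is square because the ranks agree, so [h] maps the Specht module onto [U]. *)
have fullB : row_full B.
  by rewrite /row_full; move: freeB; rewrite /row_free => /eqP->; apply/eqP.
pose w := in_submod U v *m pinvmx B.
have hw : h (val_submod w) = v.
  by rewrite /h val_submodK /w mulmxKpV ?submx_full // in_submodK.
have [A /envelop_mxP[a ->] wE] := cyclic_mxP (val_submodP w : (_ <= S)%MS).
rewrite -hw wE mulmx_sumr (big_morph h hD h0); apply: weight_sum_sum => g _.
rewrite -scalemxAr hZ -hE //; apply: weight_sumZ; apply: weight_sum_repr => //.
  by rewrite -(size_map id) map_id row_wordE size_map size_iota.
exact: weight_sum1 row_word_standard z_std.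
Qed.

End Isotypic.

Lemma isotypic_weight_sum (C : numClosedFieldType) n d nu
    (psi : 'rV[C]_#|tbasis n.+1 d|) :
    sorted geq nu -> sumn nu = n.+1 -> in_isotypic nu psi ->
  weight_sum (tensor_perm_repr C n.+1 d) (row_word 0 nu) psi.
Proof.
move=> nu_sorted nu_sum [I [U [modU [simU /sub_sumsmxP[u ->]]]]].
apply: weight_sum_sum => i _; apply: rsim_weight_sum (simU i) _ => //.
  exact: tensor_perm_unitary.
exact: submxMl.
Qed.

(** * Removable boxes, partial trace and entropy *)

Section RemovableBoxes.
Local Open Scope nat_scope.
Variable nu : seq nat.
Hypothesis nu_sorted : sorted geq nu.

Lemma count_mem_row_word j : count_mem j (row_word 0 nu) = nth 0 nu j.
Proof. exact: (count_row_word 0 nu j).1. Qed.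

Lemma nth_geq i j : i <= j -> nth 0 nu j <= nth 0 nu i.
Proof.
move=> le_ij; rewrite -!count_mem_row_word.
exact: lattice_count (lattice_row_word nu_sorted) le_ij.
Qed.

Lemma col_len_row r : nth 0 nu r.+1 < nth 0 nu r -> col_len nu (nth 0 nu r) = r.+1.
Proof.
move=> lt_r; have lt_size : r < size nu.
  by rewrite ltnNge; apply: contraTN lt_r => ?; rewrite -leqNgt nth_default.
rewrite /col_len -{2}(cat_take_drop r.+1 nu) count_cat.
have -> : count (leq (nth 0 nu r)) (take r.+1 nu) = r.+1.
  apply/eqP; rewrite -[X in _ == X](size_takel lt_size) -all_count.
  apply/(all_nthP 0) => i; rewrite size_takel // => lt_ir.
  by rewrite nth_take // nth_geq.
have -> : count (leq (nth 0 nu r)) (drop r.+1 nu) = 0; last by rewrite addn0.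
apply/eqP; rewrite -leqn0 leqNgt -has_count; apply/(has_nthP 0) => -[i _].
by rewrite nth_drop leqNgt (leq_ltn_trans _ lt_r) // nth_geq // leq_addr.
Qed.

(** Deleting the last entry leaves a standard tableau, so this entry occupies a corner of the
    shape. *)
Lemma standard_removable w (r := last 0 w) : w != [::] ->
  w \in standard_words (row_word 0 nu) -> nth 0 nu r.+1 < nth 0 nu r.
Proof.
rewrite {}/r; case/lastP: w => // w r _; rewrite last_rcons mem_standard.
rewrite lattice_rcons => /andP[/andP[lw _] /seq.permP pw].
rewrite -!count_mem_row_word -!pw !count_rcons eqxx ltn_eqF // addn0 addn1 ltnS.
exact: lattice_countS.
Qed.

Lemma removable_row r : nth 0 nu r.+1 < nth 0 nu r ->
  removable nu (col_len nu (nth 0 nu r)) (nth 0 nu r).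
Proof.
move=> lt_r; rewrite /removable col_len_row // /in_diagram /row_len /= eqxx leqnn.
by rewrite eqxx !andbT (leq_ltn_trans _ lt_r).
Qed.

(** [hook] numbers rows from 1 and [arm_leg] from 0; after this shift the hook length is
    [(arm_leg _ r i).+1]. *)
Lemma hook_bound_row (R : realType) r : nth 0 nu r.+1 < nth 0 nu r ->
  hook_bound R nu (nth 0 nu r) = exp.ln (hook_ratio R (nth 0 nu) r).
Proof.
move=> lt_r; rewrite /hook_bound col_len_row // big_add1 /=; congr exp.ln.
rewrite /hook_ratio !big_nat; apply: eq_bigr => i lt_ir.
rewrite /hook /arm_leg col_len_row // /row_len /= subSS addn1.
by rewrite -[X in (_ / (_ - X))%R]/(1%:R)%R -natrB // subn1.
Qed.

End RemovableBoxes.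

Lemma seq_argmin (d : Order.disp_t) (T : eqType) (V : orderType d) (f : T -> V) s :
  s != [::] -> exists2 x, x \in s & forall y, y \in s -> (f x <= f y)%O.
Proof.
elim: s => // x [|x' s] IHs _.
  by exists x; rewrite ?mem_head // => y; rewrite inE => /eqP->.
have [//|z zs hz] := IHs; have [le_xz|lt_zx] := leP (f x) (f z).
  exists x; rewrite ?mem_head // => y; rewrite inE => /predU1P[->//|/hz].
  exact: le_trans.
exists z; first by rewrite inE zs orbT.
by move=> y; rewrite inE => /predU1P[->|/hz//]; apply: ltW.
Qed.

Lemma bigmin_seq_le (d : Order.disp_t) (I : eqType) (V : orderType d) (F : I -> V)
    (P : pred I) x0 s i :
  i \in s -> P i -> (\big[Order.min/x0]_(j <- s | P j) F j <= F i)%O.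
Proof.
move=> + Pi; elim: s => // j s IHs; rewrite inE big_cons => /predU1P[<-|/IHs le_i].
  by rewrite Pi ge_min lexx.
by case: ifP; rewrite ?ge_min ?le_i ?orbT.
Qed.

(** * The reduced density matrix *)

Section PartialTrace.
Variables (R : realType) (n d : nat).
Local Notation C := R[i].
Local Notation basis := (tbasis n.+1 d).
Variable psi : 'rV[C]_#|basis|.
Local Notation rho := (ptrace_last (ketbra psi)).

Let agree (x y : basis) := [forall k, (k != ord_max) ==> (x k == y k)].

Let ptraceE a b : rho a b = \sum_x \sum_y (agree x y)%:R *
  ((x ord_max == a)%:R * (y ord_max == b)%:R * (tcoord psi x * (tcoord psi y)^*)).
Proof.
rewrite mxE; apply: eq_bigr => x _; rewrite big_mkcond; apply: eq_bigr => y _.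
have -> : [forall k : 'I_n.+1, if (k < n.+1.-1)%N then x k == y k
            else (x k == a) && (y k == b)] =
    [&& agree x y, x ord_max == a & y ord_max == b].
  apply/forallP/and3P => [h|[/forallP h xa yb] k].
    have := h ord_max; rewrite /= ltnn => /andP[-> ->]; split=> //.
    apply/forallP => k; apply/implyP => kn; have := h k.
    by rewrite /= ltn_neqAle kn -ltnS ltn_ord.
  have := h k; rewrite /= ltn_neqAle -[(k <= n)%N]ltnS ltn_ord andbT.
  by case: (eqVneq k ord_max) => [-> _|kn /implyP /(_ isT)]; rewrite ?eqxx ?kn ?xa.
case: (agree x y); rewrite ?mul0r // mul1r.
case: (x ord_max == a); rewrite ?mul0r // mul1r.
by case: (y ord_max == b); rewrite ?mul0r // mul1r mxE.
Qed.

Let agreeC x y : agree x y = agree y x.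
Proof. by apply: eq_forallb => k; congr (_ ==> _); exact: eq_sym. Qed.

(** Applied to the rows of the diagonalizing unitary, this turns eigenvalues of the reduced matrix
    into expectation values of [factor_proj]. *)
Lemma ptrace_form (v : 'I_d -> C) :
  \sum_a \sum_b v a * rho a b * (v b)^* =
  sform (factor_proj v (ord_max : 'I_n.+1)) psi psi.
Proof.
have -> : sform (factor_proj v (ord_max : 'I_n.+1)) psi psi =
    \sum_x \sum_y (agree x y)%:R *
      (v (x ord_max) * (v (y ord_max))^* * (tcoord psi x * (tcoord psi y)^*)).
  rewrite exchange_big /sform mxE (reindex (@enum_rank basis)) /=; last first.
    exact/onW_bij/enum_rank_bij.
  apply: eq_bigr => y _; rewrite mxE (reindex (@enum_rank basis)) /=; last first.
    exact/onW_bij/enum_rank_bij.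
  rewrite mulr_suml; apply: eq_bigr => x _; rewrite !mxE /= !enum_rankK /tcoord.
  rewrite -/(agree x y); ring.
under eq_bigr => a _ do under eq_bigr => b _ do
  rewrite ptraceE mulr_sumr mulr_suml.
under eq_bigr => a _ do rewrite exchange_big.
rewrite exchange_big; apply: eq_bigr => x _.
under eq_bigr => a _ do under eq_bigr => b _ do rewrite mulr_sumr mulr_suml.
under eq_bigr => a _ do rewrite exchange_big.
rewrite exchange_big; apply: eq_bigr => y _.
rewrite (bigD1 (x ord_max)) //= [X in _ + X]big1 ?addr0 => [|a ax].
  rewrite (bigD1 (y ord_max)) //= [X in _ + X]big1 ?addr0 => [|b byy].
    by rewrite !eqxx !mul1r; ring.
  by rewrite [_ == b]eq_sym (negPf byy) !(mul0r, mulr0).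
by rewrite big1 // => b _; rewrite [_ == a]eq_sym (negPf ax) !(mul0r, mulr0).
Qed.

Lemma ptrace_trace : \tr rho = sform 1%:M psi psi.
Proof.
rewrite /mxtrace (eq_bigr _ (fun a _ => ptraceE a a)) exchange_big /=.
rewrite sform1E (reindex (@enum_rank basis)) /=; last first.
  exact/onW_bij/enum_rank_bij.
apply: eq_bigr => x _; rewrite exchange_big (bigD1 x) //=.
rewrite [X in _ + X]big1 ?addr0 => [|y yx].
  rewrite (bigD1 (x ord_max)) //= [X in _ + X]big1 => [|a ax].
    have -> : agree x x by apply/forallP => k; rewrite eqxx implybT.
    by rewrite eqxx !mul1r !addr0 /tcoord normCK.
  by rewrite [_ == a]eq_sym (negPf ax) !(mul0r, mulr0).
rewrite big1 // => a _; have [/forallP xy|_] := boolP (agree x y); last first.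
  by rewrite mul0r.
have [xa|_] := eqVneq (x ord_max) a; last by rewrite !(mul0r, mulr0).
have [ya|_] := eqVneq (y ord_max) a; last by rewrite !(mul0r, mulr0).
case/eqP: yx; apply/ffunP => k; have [->|kn] := eqVneq k ord_max.
  by rewrite xa ya.
by have := xy k; rewrite kn => /eqP.
Qed.

Lemma ptrace_herm : rho \is hermsymmx.
Proof.
apply/is_hermitianmxP; rewrite expr0 scale1r; apply/matrixP => a b.
have -> : (rho ^t*) a b = (rho b a)^* by rewrite [LHS]mxE [in LHS]mxE.
rewrite !ptraceE rmorph_sum exchange_big; apply: eq_bigr => y _.
rewrite rmorph_sum; apply: eq_bigr => x _.
by rewrite !rmorphM !rmorph_nat /= conjCK agreeC; ring.
Qed.

End PartialTrace.

(** * Entropy in terms of eigenvalues *)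

Section SpectralEntropy.
Variables (R : realType) (d : nat) (rho : 'M[R[i]]_d).
Hypothesis rho_herm : rho \is hermsymmx.
Local Notation S := (spectralmx rho).
Local Notation lam := (spectral_diag rho).

Let rhoE : rho = invmx S *m diag_mx lam *m S.
Proof. exact: orthomx_spectralP (hermitian_normalmx rho_herm). Qed.

Lemma spectral_rowE i :
  lam 0 i = \sum_a \sum_b S i a * rho a b * (S i b)^*.
Proof.
have uS := spectral_unitarymx rho; have SU := spectral_unit rho.
have h : S *m rho *m S ^t* = diag_mx lam.
  rewrite {2}rhoE !mulmxA mulmxV // mul1mx -mulmxA.
  by have /unitarymxP-> := uS; rewrite mulmx1.
have := congr1 (fun A : 'M_d => A i i) h; rewrite /= [in RHS]mxE eqxx mulr1n => <-.
rewrite mxE exchange_big; apply: eq_bigr => b _.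
by rewrite !mxE mulr_suml; apply: eq_bigr => a _.
Qed.

Lemma spectral_row_norm i : \sum_a S i a * (S i a)^* = 1.
Proof.
have /unitarymxP/matrixP/(_ i i) := spectral_unitarymx rho.
rewrite !mxE eqxx => e; rewrite -[RHS]e; apply: eq_bigr => a _; by rewrite !mxE.
Qed.

(** The eigenvalues sum to 1, so the entropy is the average of the numbers [- ln (l i)], each at
    least [ln K] when [l i] is positive. *)
Lemma entropy_ge (K : R) : 0 < K -> \tr rho = 1 ->
  (forall i, 0 <= lam 0 i) -> (forall i, K%:C%C * lam 0 i <= 1) ->
  exp.ln K <= entropy rho.
Proof.
move=> K_gt0 tr1 lam_ge0 lam_le; pose l i := complex.Re (lam 0 i).
have lE i : lam 0 i = (l i)%:C%C by rewrite RRe_real // ger0_real.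
have l_ge0 i : 0 <= l i by have := lam_ge0 i; rewrite lE ler0c.
have l_le i : K * l i <= 1.
  by have := lam_le i; rewrite lE -rmorphM /= -[1]/(1%:C%C) lecR.
have SU := spectral_unit rho.
have trE (D : 'rV[R[i]]_d) : \tr (invmx S *m diag_mx D *m S) = \sum_i D 0 i.
  by rewrite mxtrace_mulC mulmxA mulmxV // mul1mx mxtrace_diag.
have sum_l : \sum_i l i = 1.
  apply: complexI; rewrite rmorph_sum [RHS]rmorph1 -tr1 [in RHS]rhoE trE.
  by apply: eq_bigr => i _; exact: esym (lE i).
have -> : entropy rho = - \sum_i l i * exp.ln (l i).
  rewrite /entropy; congr (- _).
  have -> : rho *m lnmx rho = invmx S *m
      diag_mx (\row_i (l i * exp.ln (l i))%:C%C) *m S.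
    rewrite {1}rhoE /lnmx !mulmxA; congr (_ *m S).
    rewrite -[_ *m S *m invmx S]mulmxA mulmxV // mulmx1 -mulmxA mulmx_diag.
    by congr (_ *m diag_mx _); apply/rowP => i; rewrite !mxE {1}lE -rmorphM.
  by rewrite trE; under eq_bigr => i _ do rewrite mxE; rewrite -rmorph_sum.
rewrite -sumrN -[exp.ln K]mul1r -sum_l mulr_suml; apply: ler_sum => i _.
have [->|l_neq0] := eqVneq (l i) 0; first by rewrite !mul0r oppr0.
have l_gt0 : 0 < l i by rewrite lt_neqAle eq_sym l_neq0 l_ge0.
rewrite -mulrN ler_pM2l // -lnV ?posrE // ler_ln ?posrE ?invr_gt0 //.
by rewrite -[(l i)^-1]mul1r ler_pdivlMr.
Qed.

End SpectralEntropy.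

Lemma hook_ratio_gt0 (F : numFieldType) c r : 0 < hook_ratio F c r.
Proof.
rewrite /hook_ratio big_nat prodr_gt0 // => i /andP[_ lt_ir].
by rewrite divr_gt0 ?ltr0n // /arm_leg; lia.
Qed.

Lemma hook_ratio_complex (R : realType) c r :
  hook_ratio R[i] c r = (hook_ratio R c r)%:C%C.
Proof.
rewrite /hook_ratio rmorph_prod; apply: eq_bigr => i _.
by rewrite fmorph_div !rmorph_nat.
Qed.

Theorem corollary2 (R : realType) (N d : nat) (nu : seq nat)
    (psi : 'rV[R[i]]_#|tbasis N d|) :
  (2 <= N)%N ->
  is_young_diagram nu N ->
  (col_len nu 1 <= d)%N ->
  in_isotypic nu psi ->
  normalized psi ->
  (min_hook_bound R nu <= (entropy (ptrace_last (ketbra psi)))%:E)%E.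
Proof.
move=> N2 /and3P[nu_sorted _ /eqP nu_sum] _ psi_iso psi_norm.
case: N psi N2 nu_sum psi_iso psi_norm => [//|n] psi _ nu_sum psi_iso psi_norm.
have psi_sum := isotypic_weight_sum nu_sorted nu_sum psi_iso.
have size_w0 : size (row_word 0 nu) = n.+1.
  by rewrite row_wordE size_map size_iota.
(* The constant [K] of the bound is the smallest hook ratio over all standard tableaux, attained at
   some tableau [w]. *)
pose f w := hook_ratio R (nth 0%N nu) (last 0%N w).
have [|w w_std w_min] := @seq_argmin _ _ _ f (standard_words (row_word 0 nu)).
  by apply: contraTneq (row_word_standard nu_sorted) => ->.
have lt_r : (nth 0 nu (last 0 w).+1 < nth 0 nu (last 0 w))%N.
  apply: standard_removable => //.
  by rewrite -size_eq0 (standard_size size_w0 w_std).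
have ratioE r : hook_ratio R[i] (fun j => count_mem j (row_word 0 nu)) r =
                hook_ratio R[i] (nth 0%N nu) r.
  by apply: eq_bigr => j _; rewrite /arm_leg !count_mem_row_word.
have psi1 : sform 1%:M psi psi = 1 by rewrite sform1E.
have entropy_ge_f : exp.ln (f w) <= entropy (ptrace_last (ketbra psi)).
  have lamE i := spectral_rowE (ptrace_herm psi) i.
  have norm_i i := spectral_row_norm (ptrace_last (ketbra psi)) i.
  apply: entropy_ge; first exact: ptrace_herm.
  - exact: hook_ratio_gt0.
  - by rewrite ptrace_trace.
  - move=> i; rewrite lamE ptrace_form sform_proj ?sform1_ge0 //.
      exact: factor_proj_herm.
    exact: factor_projK.
  - move=> i; rewrite lamE ptrace_form -psi1.
    apply: (weight_sum_bound _ size_w0) psi_sum.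
    + exact: tensor_perm_unitary.
    + exact: factor_proj_herm.
    + exact: factor_projK.
    + exact: factor_proj_comm.
    + exact: factor_proj_bound.
    move=> w' std_w'; rewrite ratioE hook_ratio_complex lecR.
    exact: w_min.
(* The last entry of [w] lies in a removable box, so [ln (f w)] is one of the terms of the
   minimum. *)
apply: (@le_trans _ _ (exp.ln (f w))%:E); last by rewrite lee_fin.
rewrite -hook_bound_row //; apply: bigmin_seq_le; last exact: removable_row.
rewrite mem_index_iota ltnS (leq_ltn_trans _ lt_r) //=.
exact: nth_geq.
Qed.
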